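(* There exists a function $f:\mathbb{N}\to\mathbb{N}$ such that the following holds. Let $m$ be a positive integer and let $G$ be an (abstract, not necessarily finite) group that possesses $m$ cyclic subgroups whose union contains all commutators $[x,y]$ with $x,y\in G$. Then $G$ has a characteristic subgroup $M$ contained in $G'$ such that $M$ is finite with $|M|\le f(m)$ and $G'/M$ is cyclic.
   Context: $G'$ denotes the derived subgroup of $G$, i.e. the subgroup generated by all commutators $[x,y]$, $x,y\in G$. *)

(* Defs.v *)
From HB Require Import structures.
From mathcomp Require Import all_boot.
From mathcomp Require Import boolp classical_sets functions cardinality.

Set Implicit Arguments.
Unset Strict Implicit.
Unset Printing Implicit Defensive.

Local Open Scope classical_set_scope.
Local Open Scope quotient_scope.
Local Open Scope group_scope.

Section Subgroups.
Variable G : groupType.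
Implicit Types A H : set G.

Definition is_subgroup H : Prop :=
  [/\ H 1,
      forall x y, H x -> H y -> H (x * y) &
      forall x, H x -> H x^-1].

Definition generated A : set G := smallest is_subgroup A.

Definition cyclic A : Prop := exists x : G, A = generated [set x].

Definition commutators : set G := [set c | exists x y : G, c = [~ x, y]].

Definition derived : set G := generated commutators.

Definition characteristic H : Prop :=
  is_subgroup H /\
  forall phi : {multiplicative G -> G}, bijective phi -> phi @` H = H.

End Subgroups.

Arguments commutators : clear implicits.
Arguments derived : clear implicits.

Record normalSubgroup (G : groupType) := NormalSubgroup {
  carrier :> set G;
  carrier_subgroup : is_subgroup carrier;
  carrier_conj : forall x y : G, carrier x -> carrier (x ^ y)
}.

Section QuotientGroup.
Variables (G : groupType) (N : normalSubgroup G).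
Implicit Types x y z : G.

Definition coset_rel : rel G := fun x y => `[< carrier N (x^-1 * y) >].

Lemma coset_rel_refl : reflexive coset_rel.
Proof.
by move=> x; apply/asboolP; rewrite mulVg; case: (carrier_subgroup N).
Qed.

Lemma coset_rel_sym : symmetric coset_rel.
Proof.
have imp x y : coset_rel x y -> coset_rel y x.
  move=> /asboolP Nxy; apply/asboolP.
  rewrite -[x]invgK -invgM.
  by case: (carrier_subgroup N) => _ _; apply.
by move=> x y; apply/idP/idP; apply: imp.
Qed.

Lemma coset_rel_trans : transitive coset_rel.
Proof.
move=> y x z /asboolP Nxy /asboolP Nyz; apply/asboolP.
have -> : x^-1 * z = (x^-1 * y) * (y^-1 * z) by rewrite -mulgA mulVKg.
by case: (carrier_subgroup N) => _ NM _; apply: NM.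
Qed.

Canonical coset_equiv :=
  EquivRel coset_rel coset_rel_refl coset_rel_sym coset_rel_trans.

(* G / N, realized as the quotient type of G by x N = y N. *)
Definition quotient_group := {eq_quot coset_rel}.

HB.instance Definition _ := Choice.on quotient_group.
HB.instance Definition _ := EqQuotient.on quotient_group.

Definition coset (x : G) : quotient_group := \pi_quotient_group x.

Lemma cosetP x y : coset x = coset y <-> carrier N (x^-1 * y).
Proof.
split=> [/eqquotP/asboolP //|Nxy].
by apply/eqquotP/asboolP.
Qed.

Lemma coset_repr (u : quotient_group) : coset (repr u) = u.
Proof. exact: reprK. Qed.

Definition quotient_mul (u v : quotient_group) : quotient_group :=
  coset (repr u * repr v).

Definition quotient_inv (u : quotient_group) : quotient_group :=
  coset (repr u)^-1.

Lemma quotient_mulE x y : quotient_mul (coset x) (coset y) = coset (x * y).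
Proof.
rewrite /quotient_mul; apply/cosetP.
have /cosetP Nx := coset_repr (coset x).
have /cosetP Ny := coset_repr (coset y).
move: (repr (coset x)) (repr (coset y)) Nx Ny => x' y' Nx Ny.
have -> : (x' * y')^-1 * (x * y) = (x'^-1 * x) ^ y' * (y'^-1 * y).
  by rewrite conjgE invgM !mulgA mulgK.
case: (carrier_subgroup N) => _ NM _; apply: NM => //.
exact: carrier_conj.
Qed.

Lemma quotient_invE x : quotient_inv (coset x) = coset x^-1.
Proof.
rewrite /quotient_inv; apply/cosetP.
have /cosetP Nx := coset_repr (coset x).
move: (repr (coset x)) Nx => x' Nx.
have -> : x'^-1^-1 * x^-1 = ((x'^-1 * x)^-1) ^ (x'^-1).
  by rewrite conjgE invgM !invgK -!mulgA mulgV mulg1.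
apply: carrier_conj.
by case: (carrier_subgroup N) => _ _; apply.
Qed.

Lemma quotient_mulA : associative quotient_mul.
Proof.
move=> u v w; rewrite -(coset_repr u) -(coset_repr v) -(coset_repr w).
by rewrite !quotient_mulE mulgA.
Qed.

Lemma quotient_mul1 : left_id (coset 1) quotient_mul.
Proof. by move=> u; rewrite -(coset_repr u) quotient_mulE mul1g. Qed.

Lemma quotient_mulr1 : right_id (coset 1) quotient_mul.
Proof. by move=> u; rewrite -(coset_repr u) quotient_mulE mulg1. Qed.

Lemma quotient_mulV : left_inverse (coset 1) quotient_inv quotient_mul.
Proof.
by move=> u; rewrite -(coset_repr u) quotient_invE quotient_mulE mulVg.
Qed.

Lemma quotient_mulVr : right_inverse (coset 1) quotient_inv quotient_mul.
Proof.
by move=> u; rewrite -(coset_repr u) quotient_invE quotient_mulE mulgV.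
Qed.

HB.instance Definition _ := isGroup.Build quotient_group
  quotient_mulA quotient_mul1 quotient_mulr1 quotient_mulV quotient_mulVr.

(* The subgroup H / N of G / N when N is contained in the subgroup H, and in
   general H N / N. *)
Definition quotient (H : set G) : set quotient_group := coset @` H.

End QuotientGroup.

Arguments coset {G} N x.
Arguments quotient {G} N H.

(* Main.v *)
(** Let K = G', let W be the set of commutators and let c_1, ..., c_m be the
generators of the cyclic subgroups covering W, which may be taken in K.

Every conjugate of w in W lies in some <c_i>, and two conjugates of w lying in
the same <c_i> generate the same subgroup. So the normaliser of <w> has index at
most m. As K is generated by m elements, the intersection K0 of these
normalisers in K has bounded index; elements of K0 act on <w> by powers, so
[K0, K0] centralises K.

If B is an abelian normal subgroup, the commutators [xa, yb] with a, b in B form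
a coset of a subgroup of B that is conjugate to [B, x][B, y^x]; by B. H.
Neumann's lemma on coverings by cosets, a bounded power of this subgroup is
cyclic. Hence, for a bounded n, [b, x]^n generates a normal subgroup of G and is
centralised by K. Applied in G/[K0, K0], together with Schur's theorem in
K/[K0, K], this bounds the exponent of K' modulo [K0, K0].

Applied in G/K', the same coset argument shows, one prime at a time, that K^k lies
in one of the <c_i> K' for a bounded k, up to exponents prime to p; so K^k K'/K' is
cyclic. As [K0, K0] is central, it follows that it has bounded exponent, hence
so has K'. Each <c_i> then contains boundedly many commutators of elements of K,
and K' is bounded by Dietzmann's argument. The subgroup sought is
M = {x in K | x^k in K'}. *)

Require Import Defs.
From HB Require Import structures.
From mathcomp Require Import all_boot.
From mathcomp Require Import ssralg ssrnum ssrint intdiv ring zify.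
From mathcomp Require Import boolp classical_sets functions cardinality.

Set Implicit Arguments.
Unset Strict Implicit.
Unset Printing Implicit Defensive.

Local Open Scope classical_set_scope.
Local Open Scope card_scope.
Local Open Scope group_scope.

Import GRing.Theory.

(** * Integer powers and subgroups *)

Section IntegerPowers.
Variable G : groupType.
Implicit Types (x y c : G) (a b z : int) (H A : set G).

Definition zpow x z : G :=
  match z with Posz n => x ^+ n | Negz n => x ^- n.+1 end.

Lemma zpow0 x : zpow x 0 = 1. Proof. by []. Qed.

Lemma zpow1 x : zpow x 1 = x. Proof. by []. Qed.

Lemma zpow_nat x n : zpow x n%:Z = x ^+ n. Proof. by []. Qed.

Lemma zpowN x z : zpow x (- z)%R = (zpow x z)^-1.
Proof.
case: z => [[|n]|n] //=; first by rewrite invg1.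
by rewrite invgK.
Qed.

Lemma zpowSr x z : zpow x (z + 1)%R = zpow x z * x.
Proof.
case: z => [n|[|n]].
- by rewrite -PoszD addn1 /= expgSr.
- by rewrite NegzE addNr /= mulVg.
have -> : (Negz n.+1 + 1 = Negz n)%R by lia.
by rewrite /= (expgS x n.+1) invgM mulgVK.
Qed.

Lemma zpowPr x z : zpow x (z - 1)%R = zpow x z * x^-1.
Proof. by rewrite -[in RHS](subrK 1%R z) zpowSr mulgK. Qed.

Lemma zpowD x a b : zpow x (a + b)%R = zpow x a * zpow x b.
Proof.
elim/int_rect: b => [|n IHn|n IHn]; first by rewrite addr0 mulg1.
- have -> : (a + n.+1 = (a + n) + 1)%R by lia.
  by rewrite zpowSr IHn -mulgA -zpowSr -PoszD addn1.
have -> : (a - n.+1%:Z = (a - n%:Z) - 1)%R by lia.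
rewrite zpowPr IHn -mulgA -zpowPr; congr (_ * zpow _ _); lia.
Qed.

Lemma zpowM x a b : zpow x (a * b)%R = zpow (zpow x a) b.
Proof.
elim/int_rect: b => [|n IHn|n IHn]; first by rewrite mulr0.
- have -> : (n.+1%:Z = n%:Z + 1)%R by lia.
  by rewrite zpowSr mulrDr mulr1 zpowD IHn.
have -> : (- n.+1%:Z = - n%:Z - 1)%R by lia.
by rewrite zpowPr mulrBr mulr1 zpowD IHn !zpowN.
Qed.

Lemma zpow1n z : zpow (1 : G) z = 1.
Proof. by case: z => n /=; rewrite expg1n ?invg1. Qed.

Lemma zpowJ x y z : zpow x z ^ y = zpow (x ^ y) z.
Proof. by case: z => n /=; rewrite ?conjVg conjXg. Qed.

Lemma commute_zpow x y z : commute x y -> commute x (zpow y z).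
Proof.
move=> xy; case: z => n /=; first exact: commuteX.
by apply: commuteV; apply: commuteX.
Qed.

Lemma zpowMn x y z : commute x y -> zpow (x * y) z = zpow x z * zpow y z.
Proof.
move=> xy; case: z => n /=; first exact: expgMn.
have xyn : commute (x ^+ n.+1) (y ^+ n.+1).
  by apply: commuteX; apply: commute_sym; apply: commuteX; apply: commute_sym.
by rewrite expgMn // xyn invgM.
Qed.

Lemma sg1 H : is_subgroup H -> H 1. Proof. by case. Qed.

Lemma sgM H x y : is_subgroup H -> H x -> H y -> H (x * y).
Proof. by case=> _ + _; apply. Qed.

Lemma sgV H x : is_subgroup H -> H x -> H x^-1.
Proof. by case=> _ _; apply. Qed.

Lemma sgX H x n : is_subgroup H -> H x -> H (x ^+ n).
Proof.
move=> sH Hx; elim: n => [|n IHn]; first exact: sg1.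
by rewrite expgS; apply: sgM.
Qed.

Lemma sgZ H x z : is_subgroup H -> H x -> H (zpow x z).
Proof.
by move=> sH Hx; case: z => n /=; [|apply: sgV => //]; apply: sgX.
Qed.

Lemma sgJ H x y : is_subgroup H -> H x -> H y -> H (x ^ y).
Proof. by move=> sH Hx Hy; apply: (sgM sH (sgV sH Hy) (sgM sH Hx Hy)). Qed.

Lemma sgR H x y : is_subgroup H -> H x -> H y -> H [~ x, y].
Proof.
move=> sH Hx Hy; apply: (sgM sH (sgV sH Hx)).
exact: (sgM sH (sgV sH Hy) (sgM sH Hx Hy)).
Qed.

Lemma sg_cancelr H x y : is_subgroup H -> H y -> H (x * y) -> H x.
Proof. by move=> sH Hy /(sgM sH)/(_ (sgV sH Hy)); rewrite mulgK. Qed.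

Lemma sg_cancell H x y : is_subgroup H -> H x -> H (x * y) -> H y.
Proof. by move=> sH Hx /(sgM sH (sgV sH Hx)); rewrite mulKg. Qed.

Lemma generated_sg A : is_subgroup (generated A).
Proof.
split=> [H [sH _]|x y Ax Ay H HA|x Ax H HA]; first exact: sg1.
- by apply: sgM; [case: HA|apply: Ax|apply: Ay].
- by apply: sgV; [case: HA|apply: Ax].
Qed.

Lemma sub_generated A : A `<=` generated A.
Proof. by move=> x Ax H [_]; apply. Qed.

Lemma generated_sub A H : is_subgroup H -> A `<=` H -> generated A `<=` H.
Proof. by move=> sH AH x; apply. Qed.

Definition cyc c : set G := [set x | exists z, x = zpow c z].

Lemma cyc_sg c : is_subgroup (cyc c).
Proof.
split=> [|x y [a ->] [b ->]|x [a ->]]; first by exists 0%R.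
  by exists (a + b)%R; rewrite zpowD.
by exists (- a)%R; rewrite zpowN.
Qed.

Lemma cyc_id c : cyc c c. Proof. by exists 1%R. Qed.

Lemma cyc_sub c H : is_subgroup H -> H c -> cyc c `<=` H.
Proof. by move=> sH Hc x [z ->]; apply: sgZ. Qed.

Lemma cyc_generated c : generated [set c] = cyc c.
Proof.
apply/seteqP; split.
  by apply: generated_sub; [apply: cyc_sg|move=> _ ->; apply: cyc_id].
by apply: cyc_sub; [apply: generated_sg|apply: sub_generated].
Qed.

Lemma cycJ c x y : cyc c x -> cyc (c ^ y) (x ^ y).
Proof. by move=> [z ->]; exists z; rewrite zpowJ. Qed.

Lemma cyc_commute c x y : cyc c x -> cyc c y -> commute x y.
Proof. by move=> [a ->] [b ->]; rewrite /commute -!zpowD addrC. Qed.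

Definition cent H : set G := [set x | forall y, H y -> commute x y].

Lemma cent_sg H : is_subgroup (cent H).
Proof.
split=> [y _|x y Cx Cy z Hz|x Cx z Hz]; first exact/commute_sym/commute1.
  by apply/commute_sym/commuteM; apply/commute_sym; [apply: Cx|apply: Cy].
by apply/commute_sym/commuteV/commute_sym/Cx.
Qed.

End IntegerPowers.

(** * Conjugates of a commutator inside a cyclic subgroup *)

Lemma collision (T : finType) (f : nat -> T) n : #|T| <= n ->
  exists i j, [/\ i < j, j <= n & f i = f j].
Proof.
move=> leTn; pose g (i : 'I_n.+1) := f i.
have /injectivePn [i [j neq_ij fij]] : ~~ injectiveb g.
  apply/negP => /injectiveP /leq_card; rewrite card_ord; lia.
have := ltn_ord i; have := ltn_ord j; rewrite !ltnS => jn in_.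
case: (ltngtP i j) => [ij|ij|/val_inj ij]; [by exists i, j|by exists j, i|].
by rewrite ij eqxx in neq_ij.
Qed.

(** [lab] separates the right cosets of [S], which bounds the index without a set of cosets. Two of
    x^0, ..., x^n lie in the same coset, and the difference of their exponents divides n!. *)
Lemma label_exponent (G : groupType) (T : finType) (lab : G -> T) (S : set G) n :
    is_subgroup S -> (forall a b, lab a = lab b -> S (a * b^-1)) ->
  #|T| <= n -> forall x, S (x ^+ n`!).
Proof.
move=> sS labS leTn x.
have [i [j [ij jn /esym/labS]]] := collision (fun i => lab (x ^+ i)) leTn.
rewrite -expgnFr; last exact: ltnW.
move=> Sx; have /dvdnP[q ->] : j - i %| n`!.
  by apply: dvdn_fact; rewrite subn_gt0 ij (leq_trans (leq_subr _ _)).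
by rewrite mulnC expgnA; apply: sgX.
Qed.

Lemma zpow_inj (G : groupType) (d : G) :
  (forall z, zpow d z = 1 -> z = 0%R) -> injective (zpow d).
Proof.
move=> dinf a b ab; apply/eqP; rewrite -subr_eq0; apply/eqP/dinf.
by rewrite zpowD zpowN ab mulgV.
Qed.

Section ConjugatesInCyclicSubgroups.
Variables (G : groupType) (m : nat) (c : 'I_m -> G).
Hypothesis covc : forall w, commutators G w -> exists i, cyc (c i) w.

Lemma commutatorsJ w y : commutators G w -> commutators G (w ^ y).
Proof. by move=> [a [b ->]]; exists (a ^ y), (b ^ y); rewrite conjRg. Qed.

(* If |f| < |e|, the conjugates of w by the powers of y that lie in a given
   <c i> are powers of c i with strictly decreasing exponents. *)
Lemma conj_exponent_le w y d e f : commutators G w ->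
    w = zpow d e -> w ^ y = zpow d f -> e != 0%R ->
    (forall z, zpow d z = 1 -> z = 0%R) -> (`|e| <= `|f|)%N.
Proof.
move=> Ww we wf e0 dinf; rewrite leqNgt; apply/negP => fe.
pose v k := w ^ (y ^+ k).
have winf z : zpow w z = 1 -> z = 0%R.
  rewrite we -zpowM => /dinf /eqP; rewrite mulf_eq0 (negPf e0) /= => /eqP //.
have vinf k z : zpow (v k) z = 1 -> z = 0%R.
  by rewrite -zpowJ => /eqP; rewrite conjg_eq1 => /eqP; apply: winf.
have vS k : zpow (v k.+1) e = zpow (v k) f.
  rewrite /v expgS conjgM -!zpowJ; congr (_ ^ _).
  by rewrite zpowJ wf we -!zpowM mulrC.
have vD j k : zpow (v (k + j)) (e ^+ j)%R = zpow (v k) (f ^+ j)%R.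
  elim: j => [|j IHj]; first by rewrite addn0.
  by rewrite addnS exprS zpowM vS -zpowM mulrC zpowM IHj -zpowM -exprSr.
have /choice[l /choice[a va]] k : exists l a, v k = zpow (c l) a.
  by have [i [z]] := covc (commutatorsJ (y ^+ k) Ww); exists i, z.
have cinf k z : zpow (c (l k)) z = 1 -> z = 0%R.
  move=> cz; apply: (vinf k).
  by rewrite va -zpowM mulrC zpowM cz zpow1n.
have a0 k : a k != 0%R.
  by apply/eqP => ak; have := vinf k 1%R; rewrite zpow1 va ak => /(_ erefl).
have dec k k' : k < k' -> l k = l k' -> (`|a k'| < `|a k|)%N.
  move=> kk' lkk'; have := vD (k' - k) k; rewrite subnKC ?(ltnW kk') //.
  rewrite !va -lkk' -!zpowM => /(zpow_inj (@cinf k)) /(congr1 absz).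
  rewrite !abszM !abszX => aef; rewrite ltnNge; apply/negP => le_aa'.
  have : (`|a k| * `|f| ^ (k' - k) < `|a k| * `|e| ^ (k' - k))%N.
    by rewrite ltn_pmul2l ?absz_gt0 // ltn_exp2r // subn_gt0.
  by rewrite ltnNge -aef leq_mul2r le_aa' orbT.
(* By descent on |a k|, each label is used only finitely often; an index beyond all these bounds
   would have no label left. *)
have finite_label i : exists K, forall k, K <= k -> l k <> i.
  have [[k0 lk0]|nlk] := pselect (exists k, l k = i); last first.
    by exists 0 => k _ lk; apply: nlk; exists k.
  have [n le_n] := ubnP `|a k0|%N.
  elim: n => // n IHn in k0 lk0 le_n *.
  have [[k1 [k01 lk1]]|nlk] := pselect (exists k, k0 < k /\ l k = i).
    apply: (IHn k1) => //; have := dec _ _ k01; rewrite lk0 lk1 => /(_ erefl).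
    by move=> lt_a; apply: leq_trans lt_a _.
  by exists k0.+1 => k lt_k lk; apply: nlk; exists k.
have [K KP] := choice finite_label.
exact: (KP (l (\max_i K i)) (\max_i K i) (leq_bigmax _)).
Qed.

(** If d has infinite order, [conj_exponent_le] for y and for y^-1 gives w^y = w or w^-1. If d has
    finite order, w^y is killed by the order of w, and in a finite cyclic group such elements are
    powers of w. *)
Lemma conj_cyc w y d : commutators G w ->
  cyc d w -> cyc d (w ^ y) -> cyc w (w ^ y).
Proof.
move=> Ww [e we] [f wf].
have [dinf|dfin] := pselect (forall z, zpow d z = 1 -> z = 0%R).
  have [e0|e0] := eqVneq e 0%R.
    by rewrite we e0 conj1g; exists 0%R.
  have f0 : f != 0%R.
    apply: contra e0 => /eqP f0; apply/eqP/dinf.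
    by apply/eqP; rewrite -we -(conjg_eq1 _ y) wf f0.
  have ef := conj_exponent_le Ww we wf e0 dinf.
  have wfV : (w ^ y) ^ y^-1 = zpow d e by rewrite conjgK.
  have fe := conj_exponent_le (commutatorsJ y Ww) wf wfV f0 dinf.
  have [fE|fE] : f = e \/ f = (- e)%R by lia.
    by exists 1%R; rewrite wf fE -we.
  by exists (-1)%R; rewrite wf fE !zpowN zpow1 -we.
have [N0 dN0 N00] : exists2 z, zpow d z = 1 & z <> 0%R.
  by move/existsNP: dfin => [z /not_implyP[dz z0]]; exists z.
have exN : exists N, (0 < N) && (d ^+ N == 1).
  exists `|N0|%N; rewrite absz_gt0; apply/andP; split; first exact/eqP.
  have := dN0; case: (intP N0) => [|n|n] //=; first by move=> /eqP.
  by move=> /eqP; rewrite invg_eq1.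
have [N /andP[N_gt0 /eqP dN] minN] := ex_minnP exN.
have ordN z : zpow d z = 1 -> (N %| z)%Z.
  move=> dz; apply/dvdz_mod0P; have : zpow d (z %% N)%Z = 1.
    have := dz; rewrite [in LHS](divz_eq z N) zpowD mulrC zpowM zpow_nat dN.
    by rewrite zpow1n mul1g.
  have [r rE] : exists r : nat, (z %% N)%Z = r.
    by exists `|(z %% N)%Z|%N; rewrite gez0_abs // modz_ge0; lia.
  rewrite rE => dr; case: r rE dr => [//|r rE dr].
  have := minN r.+1; rewrite /= -[d ^+ _]/(zpow d r.+1) dr eqxx => /(_ erefl).
  by have := @ltz_pmod z N; rewrite rE; lia.
pose g := gcdz e N.
have [q eq] := dvdzP (dvdz_gcdl e N).
have [N' eN] := dvdzP (dvdz_gcdr e N).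
have fN : zpow d (f * N')%R = 1.
  rewrite zpowM -wf -zpowJ we -zpowM eq -mulrA [(_ * N')%R]mulrC -eN mulrC.
  by rewrite zpowM zpow_nat dN zpow1n conj1g.
have /dvdzP[r fr] : (g %| f)%Z.
  have /dvdzP[t] := ordN _ fN; rewrite {1}eN => ft.
  have N'0 : N' != 0%R by apply: contraL N_gt0 => /eqP N'0; lia.
  apply/dvdzP; exists t; apply: (mulIf N'0).
  by rewrite ft mulrAC mulrA.
have [u [v]] := Bezoutz e N; rewrite -/g => uv.
exists (u * r)%R; rewrite wf fr -uv we -zpowM.
have -> : (r * (u * e + v * N%:Z) = e * (u * r) + N%:Z * (v * r))%R by ring.
by rewrite zpowD [X in _ * X]zpowM zpow_nat dN zpow1n mulg1.
Qed.

(** The normaliser of <w>. The condition on x alone would only say that conjugation maps <w> into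
    itself, possibly properly if <w> is infinite. *)
Definition stab w : set G := [set x | cyc w (w ^ x) /\ cyc w (w ^ x^-1)].

Lemma stab_sg w : is_subgroup (stab w).
Proof.
split=> [|x y [wx wVx] [wy wVy]|x [wx wVx]].
- by split; rewrite ?invg1 conjg1; apply: cyc_id.
- split.
  + have [z wxz] := wx; rewrite conjgM wxz zpowJ.
    exact: sgZ (cyc_sg _) wy.
  + have [z wyz] := wVy; rewrite invgM conjgM wyz zpowJ.
    exact: sgZ (cyc_sg _) wVx.
- by split; rewrite ?invgK.
Qed.

(** Label x by some i with w^x in <c i>. If x and y share a label, [conj_cyc] applies to w^x and w^y
    in both orders. *)
Lemma stab_label w : commutators G w ->
  exists lab : G -> 'I_m, forall x y, lab x = lab y -> stab w (x * y^-1).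
Proof.
move=> Ww; have /choice[lab labP] x : exists i, cyc (c i) (w ^ x).
  exact/covc/commutatorsJ.
have half x y : lab x = lab y -> cyc w (w ^ (y * x^-1)).
  move=> lxy; have cy := labP y; rewrite -lxy in cy.
  have : cyc (w ^ x) ((w ^ x) ^ (x^-1 * y)).
    apply: (conj_cyc _ (labP x)); first exact: commutatorsJ.
    by rewrite -conjgM mulVKg.
  by move=> /(cycJ x^-1); rewrite -!conjgM !mulgA !mulgV mul1g conjg1.
exists lab => x y lxy; split; first exact/half.
by rewrite invgM invgK; apply: half.
Qed.

(** x and y act on <w> by power maps, and power maps commute. *)
Lemma stab_commute w x y : stab w x -> stab w y -> commute [~ x, y] w.
Proof.
move=> /(sgV (stab_sg w)) + /(sgV (stab_sg w)).
rewrite -[in [~ _, _]](invgK x) -[in [~ _, _]](invgK y).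
move: x^-1 y^-1 => {}x {}y [[a wx] _] [[b wy] _].
have wxy : w ^ (x * y) = w ^ (y * x).
  by rewrite !conjgM wx wy !zpowJ wx wy -!zpowM mulrC.
apply/commute_sym/commgP; rewrite -conjg_fix; apply/eqP.
have -> : [~ x^-1, y^-1] = (x * y) * (y * x)^-1 by rewrite /commg /conjg !gnorm.
by rewrite conjgM wxy conjgK.
Qed.
End ConjugatesInCyclicSubgroups.

(** * Coverings by cosets *)

(** Eliminating one subgroup from a covering by k cosets leaves at most k + k * k cosets of the
    others. *)
Definition neumann_bound r N := iter r (fun k => k + k * k) N.

(* If no coset of S i is left over, S i has few cosets; otherwise a missed coset
   t S i lies in the union of the other cosets, hence so does every coset of
   S i, up to a translation. *)
Lemma neumann (G : groupType) (I : eqType) (S : I -> set G) (H : set G)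
    (ids : seq I) N (s : seq (G * I)) :
    is_subgroup H -> (forall i, is_subgroup (S i)) ->
    {subset unzip2 s <= ids} -> size s <= N -> (forall p, p \in s -> H p.1) ->
    (forall h, H h -> exists2 p, p \in s & S p.2 (p.1^-1 * h)) ->
  exists2 i, i \in unzip2 s & exists2 t : seq G,
    size t <= neumann_bound (size ids) N &
    forall h, H h -> exists2 g, g \in t & S i (g^-1 * h).
Proof.
move=> sH sS; elim: ids N s => [|i ids IHids] N s sub_ids le_s Hs cov.
  have [p ps _] := cov 1 (sg1 sH).
  by have := sub_ids p.2; rewrite map_f // => /(_ isT).
pose si := [seq p <- s | p.2 == i]; pose sj := [seq p <- s | p.2 != i].
have [cov_i|] := pselect (forall h, H h -> exists2 p, p \in si & S i (p.1^-1 * h)).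
  exists i.
    have [p] := cov_i 1 (sg1 sH); rewrite mem_filter => /andP[/eqP <- ps] _.
    exact: map_f.
  exists (unzip1 si) => [|h /cov_i[p psi Sp]]; last by exists p.1; rewrite ?map_f.
  rewrite size_map size_filter (leq_trans (count_size _ _)) // (leq_trans le_s) //.
  elim: (size (i :: ids)) N {le_s} => //= n IHn N.
  by rewrite (leq_trans (IHn N)) // leq_addr.
move=> /existsNP[t /not_implyP[Ht Nt]].
pose s' := sj ++ [seq (p.1 * t^-1 * q.1, q.2) | p <- si, q <- sj].
have sub_s' : {subset unzip2 s' <= unzip2 sj}.
  move=> j /mapP[p]; rewrite mem_cat => /orP[ps ->|]; first exact: map_f.
  by case/allpairsP => [[p1 q1] /= [_ q1s ->] ->] /=; apply: map_f.
have le_si : size si <= N.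
  by rewrite size_filter (leq_trans (count_size _ _)).
have le_sj : size sj <= N.
  by rewrite size_filter (leq_trans (count_size _ _)).
have [||||j js' [u le_u uP]] := IHids (N + N * N) s'.
- move=> j /sub_s' /mapP[p]; rewrite mem_filter => /andP[pi ps] ->.
  by have := sub_ids p.2; rewrite map_f // inE (negPf pi) => /(_ isT).
- by rewrite size_cat size_allpairs leq_add ?leq_mul.
- move=> p; rewrite mem_cat => /orP[|/allpairsP[[p1 q1] [/=]]].
    by rewrite mem_filter => /andP[_]; apply: Hs.
  rewrite !mem_filter => /andP[_ /Hs Hp1] /andP[_ /Hs Hq1] -> /=.
  by apply: (sgM sH) Hq1; apply: sgM (sgV sH _).
- move=> h Hh; have [p ps Sp] := cov h Hh.
  have [pi|pi] := eqVneq p.2 i; last first.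
    by exists p => //; rewrite mem_cat mem_filter pi ps.
  rewrite pi in Sp; have Hp := Hs p ps.
  have [|q qs Sq] := cov (t * (p.1^-1 * h)).
    by apply: (sgM sH Ht); apply: (sgM sH _ Hh); apply: sgV.
  have qi : q.2 != i.
    apply/eqP => qi; rewrite qi in Sq; apply: Nt; exists q.
      by rewrite mem_filter qi eqxx.
    by apply: (sg_cancelr (sS i) Sp); rewrite -mulgA.
  exists (p.1 * t^-1 * q.1, q.2) => /=.
    rewrite mem_cat; apply/orP; right; apply/allpairsP; exists (p, q).
    by rewrite !mem_filter pi qi eqxx ps qs.
  by rewrite !invgM invgK -!mulgA.
exists j; last by exists u; rewrite // /neumann_bound [size (i :: _)]/= iterSr.
have /mapP[p] := sub_s' j js'; rewrite mem_filter => /andP[_ ps] ->.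
exact: map_f.
Qed.

(** The coverings below use at most two cosets of each of m subgroups, hence [m.*2]. The factorial
    absorbs every exponent difference found by pigeonhole. *)
Definition neumann_exponent m := (neumann_bound m m.*2).+1`!.

(** Two powers of h lie in the same one of the boundedly many cosets of S i. That i occurs in s is
    recorded because callers attach properties to the indices they list. *)
Lemma neumann_power (G : groupType) m (S : 'I_m -> set G) (H : set G)
    (s : seq (G * 'I_m)) :
    is_subgroup H -> (forall i, is_subgroup (S i)) -> size s <= m.*2 ->
    (forall p, p \in s -> H p.1) ->
    (forall h, H h -> exists2 p, p \in s & S p.2 (p.1^-1 * h)) ->
  exists2 i, i \in unzip2 s & forall h, H h -> S i (h ^+ neumann_exponent m).
Proof.
move=> sH sS le_s Hs cov.
have [|i i_s [t le_t tP]] := neumann (ids := enum 'I_m) sH sS _ le_s Hs cov.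
  by move=> i _; rewrite mem_enum.
exists i => // h Hh; rewrite size_enum_ord in le_t.
have /choice[g gP] k : exists g, g \in t /\ S i (g^-1 * h ^+ k).
  by have [g] := tP _ (sgX k sH Hh); exists g.
pose f k : 'I_(size t).+1 := inord (index (g k) t).
have [|a [b [ab lb fab]]] := @collision _ f (neumann_bound m m.*2).+1.
  by rewrite card_ord ltnS.
have gab : g a = g b.
  move/(congr1 val): fab; rewrite /= !inordK ?ltnS ?index_size // => gab.
  by rewrite -(nth_index 1 (gP a).1) gab nth_index // (gP b).1.
have Sab : S i (h ^+ (b - a)).
  have hb : h ^+ b = h ^+ a * h ^+ (b - a) by rewrite -expgnDr subnKC // ltnW.
  have Sb := (gP b).2; rewrite hb mulgA -gab in Sb.
  exact: sg_cancell (sS i) (gP a).2 Sb.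
have /dvdnP[q ->] : b - a %| neumann_exponent m.
  by apply: dvdn_fact; rewrite subn_gt0 ab (leq_trans (leq_subr _ _)).
by rewrite mulnC expgnA; apply: sgX.
Qed.

(** * Normal sets of generators *)

Definition prodw (G : groupType) (s : seq G) : G := foldr (fun x y => x * y) 1 s.

Lemma prodw_cat (G : groupType) (s t : seq G) : prodw (s ++ t) = prodw s * prodw t.
Proof. by elim: s => [|x s IHs] /=; rewrite ?mul1g // IHs mulgA. Qed.

Lemma prodw_nseq (G : groupType) n (x : G) : prodw (nseq n x) = x ^+ n.
Proof. by elim: n => //= n ->; rewrite expgS. Qed.

Definition card_le (T : eqType) (A : set T) n :=
  exists2 s : seq T, size s <= n & forall x, A x -> x \in s.

Section Words.
Variables (G : groupType) (X : set G).
Hypothesis XJ : forall x y, X x -> X y -> X (x ^ y).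
Hypothesis XV : forall x, X x -> X x^-1.

Lemma generated_word g : generated X g ->
  exists2 s : seq G, (forall x, x \in s -> X x) & g = prodw s.
Proof.
apply: (@generated_sub _ X
  [set g | exists2 s : seq G, (forall x, x \in s -> X x) & g = prodw s]).
  split=> [|x y [s sX ->] [t tX ->]|x [s sX ->]]; first by exists [::].
    exists (s ++ t) => [z|]; last by rewrite prodw_cat.
    by rewrite mem_cat => /orP[/sX|/tX].
  exists (rev [seq z^-1 | z <- s]) => [z|].
    by rewrite mem_rev => /mapP[y /sX/XV Xy ->].
  elim: s {sX} => [|y s IHs] /=; first by rewrite invg1.
  by rewrite rev_cons -cats1 prodw_cat -IHs invgM /= mulg1.
move=> x Xx; exists [:: x]; last by rewrite /= mulg1.
by move=> y; rewrite inE => /eqP ->.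
Qed.

(** Moving a letter x to the front conjugates the letters it passes; they stay in X and their number
    does not change. *)
Lemma collect x (s : seq G) k : X x -> (forall y, y \in s -> X y) ->
  k <= count_mem x s ->
  exists t : seq G, [/\ forall y, y \in t -> X y, size s = k + size t
                      & prodw s = x ^+ k * prodw t].
Proof.
move=> Xx; elim: s k => [|y s IHs] [|k] sX //.
- by exists [::]; rewrite mul1g.
- by exists (y :: s); rewrite mul1g.
have Xs z : z \in s -> X z by move=> zs; apply: sX; rewrite inE zs orbT.
rewrite /=; have [->|yx] := eqVneq y x.
  rewrite add1n ltnS => /(IHs _ Xs)[t [tX -> ->]].
  by exists t; rewrite expgS mulgA addSn.
rewrite add0n => /(IHs _ Xs)[t [tX -> ->]].
exists (y ^ (x ^+ k.+1) :: t); split.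
- move=> z; rewrite inE => /orP[/eqP ->|/tX //].
  have Xy : X y by apply: sX; rewrite inE eqxx.
  elim: k.+1 => [|n IHn]; first by rewrite conjg1.
  by rewrite expgSr conjgM; apply: XJ.
- by rewrite /= addnS.
by rewrite [LHS]mulgA (conjgC y) -mulgA.
Qed.

Lemma size_count_le (l s : seq G) k : {subset s <= l} ->
  (forall x, count_mem x s <= k) -> size s <= size l * k.
Proof.
elim: l s => [|x l IHl] s sl le_k.
  by case: s sl {le_k} => // y s /(_ y); rewrite inE eqxx => /(_ isT).
rewrite -(count_predC (pred1 x)) /= mulSn leq_add // -size_filter IHl //.
  move=> y; rewrite mem_filter /= => /andP[yx /sl].
  by rewrite inE (negPf yx).
move=> y; rewrite (leq_trans _ (le_k y)) // count_filter.
by apply: sub_count => z /= /andP[].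
Qed.

(** Dietzmann's argument: among more than N * e.-1 letters some letter occurs e times; gathered at
    the front, these e letters are replaced by fewer. So words of length at most N * e.-1
    suffice. *)
Lemma generated_card N e : card_le X N -> 0 < e ->
    (forall x, X x -> exists2 s : seq G,
       (forall y, y \in s -> X y) & size s < e /\ x ^+ e = prodw s) ->
  card_le (generated X) (N.+1 ^ (N * e.-1)).
Proof.
move=> [l le_l Xl] e_gt0 short.
have short_word (s : seq G) : (forall x, x \in s -> X x) ->
    exists2 t : seq G, (forall x, x \in t -> X x) &
      size t <= N * e.-1 /\ prodw s = prodw t.
  have [n le_n] := ubnP (size s).
  elim: n s le_n => // n IHn s le_n sX.
  have [le_s|lt_s] := leqP (size s) (N * e.-1); first by exists s.
  have [x le_x] : exists x, e <= count_mem x s.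
    apply/not_existsP => cnt; move: lt_s; apply/negP; rewrite -leqNgt.
    apply: leq_trans (@size_count_le l s e.-1 _ _) _.
    - by move=> x /sX /Xl.
    - by move=> x; have /negP := cnt x; rewrite -ltnNge -[e in _ < e]prednK.
    - by rewrite leq_mul2r le_l orbT.
  have Xx : X x.
    by apply/sX; rewrite -has_pred1 has_count (leq_trans e_gt0).
  have [t [tX st ->]] := collect Xx sX le_x.
  have [u uX [lt_u ->]] := short x Xx.
  rewrite -prodw_cat; apply: IHn => [|z].
    by rewrite size_cat; rewrite st in le_n; lia.
  by rewrite mem_cat => /orP[/uX|/tX].
(* Words of length at most n, padded by the extra letter 1: this is the source of [N.+1]. *)
pose W n := iter n (fun w => [seq x * y | x <- 1 :: l, y <- w]) [:: 1].
have sizeW n : size (W n) <= N.+1 ^ n.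
  elim: n => //= n IHn; rewrite size_cat size_map size_allpairs expnS mulSn.
  by rewrite leq_add // leq_mul.
have memW (s : seq G) n : (forall x, x \in s -> X x) -> size s <= n ->
    prodw s \in W n.
  elim: n s => [|n IHn] [|x s] //= sX; first by rewrite inE.
    move=> _; rewrite mem_cat; apply/orP; left; apply/mapP.
    by exists (prodw [::]); [exact: IHn|rewrite mul1g].
  rewrite ltnS => le_s; rewrite mem_cat; apply/orP; right; apply/allpairsP.
  exists (x, prodw s); split=> //=; first by apply/Xl/sX; rewrite inE eqxx.
  by apply: IHn => // y ys; apply: sX; rewrite inE ys orbT.
exists (W (N * e.-1)%N) => [|g /generated_word[s sX ->]]; first exact: sizeW.
have [t tX [le_t ->]] := short_word s sX.
exact: memW.
Qed.
End Words.

(* Rosenlicht's identity: if z = [x, y]^n is central, then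
   [x, y]^(n+1) = [x, y^2] ([x, y]^y)^(n-1). *)
Lemma commg_exp_identity (G : groupType) (x y : G) n :
    commute y ([~ x, y] ^+ n.+1) ->
  [~ x, y] ^+ n.+2 = [~ x, y ^+ 2] * ([~ x, y] ^ y) ^+ n.
Proof.
move=> yz; rewrite expgS [X in _ = X * _]/commg.
have -> : x ^ (y ^+ 2) = x * [~ x, y ^+ 2] by rewrite /commg mulVKg.
rewrite mulKg -conjXg.
have -> : [~ x, y] * [~ x, y] ^+ n.+1 = x^-1 * y^-1 * x * [~ x, y] ^+ n.+1 * y.
  by rewrite -(mulgA (x^-1 * y^-1 * x)) -yz /commg /conjg !mulgA.
by rewrite expgS expg2 /commg /conjg !gnorm.
Qed.

Lemma card_le_exponent (G : groupType) (H : set G) n :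
  is_subgroup H -> card_le H n -> forall x, H x -> x ^+ n.+1`! = 1.
Proof.
move=> sH [s le_s Hs] x Hx.
pose f k : 'I_(size s).+1 := inord (index (x ^+ k) s).
have [|i [j [ij jn fij]]] := @collision _ f n.+1; first by rewrite card_ord.
have xij : x ^+ i = x ^+ j.
  have s_x k : x ^+ k \in s by apply: Hs; apply: sgX.
  move/(congr1 val): fij; rewrite /= !inordK ?ltnS ?index_size // => fij.
  by rewrite -(nth_index 1 (s_x i)) fij nth_index.
have x1 : x ^+ (j - i) = 1 by rewrite expgnFr ?(ltnW ij) // xij mulgV.
have /dvdnP[q ->] : j - i %| n.+1`!.
  by apply: dvdn_fact; rewrite subn_gt0 ij (leq_trans (leq_subr _ _)).
by rewrite mulnC expgnA x1 expg1n.
Qed.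

Lemma commgMl_commute (G : groupType) (u x y : G) :
  commute u y -> [~ u * x, y] = [~ x, y].
Proof.
move=> /commuteV uy.
by rewrite /commg /conjg invgM !mulgA -(mulgA _ y^-1 u) -uy !mulgA mulgVK.
Qed.

Lemma commgMr_commute (G : groupType) (x v y : G) :
  commute x v -> [~ x, v * y] = [~ x, y].
Proof.
by move=> xv; rewrite -invgR commgMl_commute ?invgR //; apply: commute_sym.
Qed.

(** A commutator depends only on the labels of its two entries, so there are at most B * B of them.
    As [x, y]^(n+1) is central, Rosenlicht's identity writes [x, y]^(n+2) as a product of n+1
    commutators, as Dietzmann's argument requires. *)
Lemma schur (G : groupType) (H : set G) B n (lab : G -> 'I_B) : is_subgroup H ->
    (forall x y, H x -> H y -> lab x = lab y -> cent H (x * y^-1)) ->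
    (forall x, H x -> cent H (x ^+ n.+1)) ->
  card_le (generated [set w | exists x y, [/\ H x, H y & w = [~ x, y]]])
    ((B * B).+1 ^ (B * B * n.+1)).
Proof.
move=> sH labC expC; set X := [set w | _].
have XJ x y : X x -> H y -> X (x ^ y).
  move=> [a [b [Ha Hb ->]]] Hy; exists (a ^ y), (b ^ y).
  by rewrite conjRg; split=> //; apply: sgJ.
have XH x : X x -> H x by move=> [a [b [Ha Hb ->]]]; apply: sgR.
have cardX : card_le X (B * B).
  pose P k x := H x /\ lab x = k.
  pose r k := xget 1 [set x | P k x].
  have rP x : H x -> H (r (lab x)) /\ lab (r (lab x)) = lab x.
    by move=> Hx; apply: (@xgetPex _ 1 [set y | P (lab x) y]); exists x.
  exists [seq [~ r i, r j] | i <- enum 'I_B, j <- enum 'I_B].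
    by rewrite size_allpairs size_enum_ord.
  move=> _ [x [y [Hx Hy ->]]]; apply/allpairsP; exists (lab x, lab y).
  rewrite !mem_enum; split=> //=.
  have [[Hrx lx] [Hry ly]] := (rP x Hx, rP y Hy).
  have cx := labC _ _ Hx Hrx (esym lx); have cy := labC _ _ Hy Hry (esym ly).
  rewrite -[in LHS](mulgVK (r (lab x)) x) commgMl_commute; last exact: cx.
  rewrite -[in LHS](mulgVK (r (lab y)) y) commgMr_commute //.
  exact/commute_sym/cy.
apply: (@generated_card _ X _ _ _ n.+2 cardX) => //.
- by move=> x y Xx /XH; apply: XJ.
- by move=> _ [x [y [Hx Hy ->]]]; exists y, x; rewrite invgR.
move=> _ [x [y [Hx Hy ->]]].
have Hxy := sgR sH Hx Hy.
rewrite commg_exp_identity; last exact/commute_sym/expC.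
exists ([~ x, y ^+ 2] :: nseq n ([~ x, y] ^ y)) => [w|].
  rewrite inE => /orP[/eqP ->|/nseqP[-> _]].
    by exists x, (y ^+ 2); split; last by []; [|apply: sgX].
  by apply: XJ => //; exists x, y.
by rewrite /= size_nseq prodw_nseq.
Qed.

(** * Subgroups of bounded index in a finitely generated group *)

Section CosetTables.
Variables (G : groupType) (m : nat) (c : 'I_m -> G).

(** A coset table: how right multiplication by [c i] (boolean true) or by its inverse moves the m
    labels. *)
Definition table := {ffun 'I_m * ('I_m * bool) -> 'I_m}.

Definition has_table (lab : G -> 'I_m) (tau : table) :=
  forall x i b, lab (x * (if b then c i else (c i)^-1)) = tau (lab x, (i, b)).

Lemma table_transport lab lab' tau : has_table lab tau -> has_table lab' tau ->
  forall x, generated (range c) x ->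
  forall z z', lab z = lab' z' -> lab (z * x) = lab' (z' * x).
Proof.
move=> tl tl' x Kx.
(* The claim for x^-1 is carried along so that the set of such x is closed under inverses. *)
suff [] : (forall z z', lab z = lab' z' -> lab (z * x) = lab' (z' * x)) /\
  (forall z z', lab z = lab' z' -> lab (z * x^-1) = lab' (z' * x^-1)) by [].
move: x Kx; apply: (@generated_sub _ _ [set x |
  (forall z z', lab z = lab' z' -> lab (z * x) = lab' (z' * x)) /\
  (forall z z', lab z = lab' z' -> lab (z * x^-1) = lab' (z' * x^-1))]).
  split=> [|x y [tx tVx] [ty tVy]|x [tx tVx]].
  - by split=> z z'; rewrite ?invg1 !mulg1.
  - by split=> z z' zz'; rewrite ?invgM !mulgA; [apply/ty/tx|apply/tVx/tVy].
  - by split; rewrite ?invgK.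
move=> _ [i _ <-]; split=> z z' zz'.
  by have := tl z i true; have := tl' z' i true; rewrite zz' => -> ->.
by have := tl z i false; have := tl' z' i false; rewrite zz' => -> ->.
Qed.

(** Labelling a chosen representative of each coset makes labels constant on cosets, so that right
    multiplication acts on them. *)
Lemma canonical_label (S : set G) (lab : G -> 'I_m) : is_subgroup S ->
    (forall x y, lab x = lab y -> S (x * y^-1)) ->
  exists lab' : G -> 'I_m, forall x y, lab' x = lab' y <-> S (x * y^-1).
Proof.
move=> sS labS; pose r x := xget 1 [set y | S (y * x^-1)].
have rP x : S (r x * x^-1).
  apply: (@xgetPex _ 1 [set y | S (y * x^-1)]); exists x.
  by rewrite /= mulgV; apply: sg1.
exists (lab \o r) => x y; split=> [/labS Srr|Sxy].
  have := sgM sS (sgM sS (sgV sS (rP x)) Srr) (rP y).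
  by rewrite invgM invgK !mulgA !mulgVK.
congr (lab (xget 1 _)); apply/seteqP; split=> z /= Sz.
  by have := sgM sS Sz Sxy; rewrite mulgA mulgVK.
by have := sgM sS Sz (sgV sS Sxy); rewrite invgM invgK mulgA mulgVK.
Qed.

Lemma label_table (S : set G) (lab : G -> 'I_m) :
    (forall x y, lab x = lab y <-> S (x * y^-1)) -> exists tau, has_table lab tau.
Proof.
move=> labS; pose r l := xget 1 [set x | lab x = l].
exists [ffun p : 'I_m * ('I_m * bool) =>
  lab (r p.1 * (if p.2.2 then c p.2.1 else (c p.2.1)^-1))] => x i b.
rewrite ffunE /=; apply/labS.
have /labS : lab (r (lab x)) = lab x.
  by apply: (@xgetPex _ 1 [set y | lab y = lab x]); exists x.
move=> Sr; have : lab x = lab (r (lab x)) by apply/esym/labS.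
move/labS; move: (if b then _ else _) => u.
by rewrite invgM mulgA mulgK.
Qed.

(** One label for each coset table and each label of 1, so that all subgroups that can occur are
    treated at once. *)
Definition code := {ffun table * 'I_m -> 'I_m}.

(* A coset labelling of a subgroup of index at most m of <c 1, ..., c m> is
   determined by the action of the generators on labels, so F contains boundedly
   many subgroups up to their trace on <c 1, ..., c m>. *)
Lemma common_label (F : set (set G)) :
    (forall S, F S -> is_subgroup S /\
       exists lab : G -> 'I_m, forall x y, lab x = lab y -> S (x * y^-1)) ->
  exists lab : G -> code, forall x y, generated (range c) x ->
    generated (range c) y -> lab x = lab y -> forall S, F S -> S (x * y^-1).
Proof.
move=> FP.
pose R tau l (lab : G -> 'I_m) := has_table lab tau /\ lab 1 = l.
have /choice[L LP] (p : table * 'I_m) :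
    exists L, (exists lab, R p.1 p.2 lab) -> R p.1 p.2 L.
  have [[lab Rlab]|nR] := pselect (exists lab, R p.1 p.2 lab); first by exists lab.
  by exists (fun=> p.2) => /nR.
exists (fun x => [ffun p => L p x]) => x y Kx Ky /ffunP eqL S FS.
have [sS [lab0 lab0S]] := FP S FS.
have [lab labS] := canonical_label sS lab0S.
have [tau tl] := label_table labS.
have [tL L1] : R tau (lab 1) (L (tau, lab 1)).
  by apply: (LP (tau, lab 1)); exists lab.
have labL z : generated (range c) z -> lab z = L (tau, lab 1) z.
  by move=> Kz; have := table_transport tl tL Kz (esym L1); rewrite !mul1g.
have := eqL (tau, lab 1); rewrite !ffunE => eqL1.
by apply/labS; rewrite (labL x Kx) (labL y Ky) eqL1.
Qed.
End CosetTables.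

(** * Abelian normal subgroups *)

Section AbelianNormalSubgroup.
Variables (G : groupType) (m : nat) (c : 'I_m -> G).
Hypothesis covc : forall w, commutators G w -> exists i, cyc (c i) w.
Variable B : set G.
Hypotheses (sB : is_subgroup B) (nB : forall x y, B x -> B (x ^ y)).
Hypothesis aB : forall x y, B x -> B y -> commute x y.
Let n := neumann_exponent m.

Lemma comm_normal b x : B b -> B [~ b, x].
Proof. by move=> Bb; rewrite commgEl; apply: (sgM sB (sgV sB Bb) (nB x Bb)). Qed.

Lemma commBM a b x : B a -> B b -> [~ a * b, x] = [~ a, x] * [~ b, x].
Proof.
move=> Ba Bb; rewrite !commgEl conjMg (aB Ba Bb) invgM.
move: (a ^ x) (b ^ x) (nB x Ba) => p q Bp.
by rewrite -!mulgA; congr (_ * _); rewrite !mulgA (aB (sgV sB Bb) Bp).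
Qed.

Lemma commBV b x : B b -> [~ b^-1, x] = [~ b, x]^-1.
Proof.
move=> Bb; have /esym := commBM x Bb (sgV sB Bb).
by rewrite mulgV comm1g => /mulg1_eq ->.
Qed.

Lemma commBX b x k : B b -> [~ b ^+ k, x] = [~ b, x] ^+ k.
Proof.
move=> Bb; elim: k => [|k IHk]; first by rewrite comm1g.
by rewrite !expgS commBM ?IHk //; apply: sgX.
Qed.

Lemma mulgACA_abelian p q r s : B q -> B r -> p * q * (r * s) = p * r * (q * s).
Proof. by move=> Bq Br; rewrite -!mulgA (mulgA q) (aB Bq Br) !mulgA. Qed.

(* [x, y] times this subgroup is the set of all [x a, y b^-1] with a, b in B. *)
Definition shifts x y : set G := [set h | exists a b,
  [/\ B a, B b & h = [~ a, y ^ x] ^ [~ x, y] * [~ b, x ^ y]]].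

Lemma shifts_sg x y : is_subgroup (shifts x y).
Proof.
have BR a z u : B a -> B ([~ a, z] ^ u) by move=> Ba; apply/nB/comm_normal.
split=> [|h k [a [b [Ba Bb ->]]] [a' [b' [Ba' Bb' ->]]]|h [a [b [Ba Bb ->]]]].
- by exists 1, 1; split; rewrite ?comm1g ?conj1g ?mulg1 //; apply: sg1.
- exists (a * a'), (b * b'); split; [exact: sgM|exact: sgM|].
  rewrite !commBM // (conjMg [~ a, y ^ x]).
  by rewrite mulgACA_abelian //; [apply: comm_normal|apply: BR].
exists a^-1, b^-1; split; [exact: sgV|exact: sgV|].
rewrite !commBV // conjVg -invgM; congr (_^-1); apply: aB; last exact: comm_normal.
exact: BR.
Qed.

Lemma commg_shift x y a b : B a -> B b ->
  [~ x * a, y * b^-1] =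
  [~ x, y] * ([~ a, y ^ x] ^ [~ x, y] * [~ b, x ^ y]).
Proof.
move=> Ba Bb; set u := [~ x, y].
have -> : [~ x * a, y * b^-1] = u * ((a ^ u)^-1 * (b ^ (x * u)) * a ^ y * b^-1).
  by rewrite /u /commg /conjg !gnorm.
have -> : [~ a, y ^ x] ^ u = (a ^ u)^-1 * a ^ y.
  by rewrite /u /commg /conjg !gnorm.
have -> : [~ b, x ^ y] = b^-1 * b ^ (x * u) by rewrite /u /commg /conjg !gnorm.
move: (a ^ u) (a ^ y) (b ^ (x * u)) (nB y Ba) (nB (x * u) Bb) => p q r Bq Br.
by rewrite -!mulgA (aB (sgV sB Bb) Br) (mulgA r) (aB Br Bq) -mulgA.
Qed.

(** Fix for each possible i one g i in the subgroup with u * g i in <c i>. Any other h with u * h in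
    <c i> lies in the coset of g i, and Neumann's lemma applies to these cosets. *)
Lemma shifts_power x y : exists i,
  (exists2 h, shifts x y h & cyc (c i) ([~ x, y] * h)) /\
  (forall h, shifts x y h -> cyc (c i) (h ^+ n)).
Proof.
set u := [~ x, y]; set H := shifts x y.
pose g i := xget 1 [set h | H h /\ cyc (c i) (u * h)].
pose s := [seq (g i, i) | i <- enum 'I_m & `[< exists h, H h /\ cyc (c i) (u * h) >]].
have gP i : (exists h, H h /\ cyc (c i) (u * h)) -> H (g i) /\ cyc (c i) (u * g i).
  by move=> ex; apply: (@xgetPex _ 1 [set h | H h /\ cyc (c i) (u * h)]).
have [|||p|h Hh|i i_s iP] := @neumann_power G m (fun i => cyc (c i)) H s.
- exact: shifts_sg.
- by move=> i; apply: cyc_sg.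
- rewrite size_map size_filter (leq_trans (count_size _ _)) //.
  by rewrite size_enum_ord -addnn leq_addr.
- by move=> /mapP[i]; rewrite mem_filter => /andP[/asboolP /gP[Hg _] _] ->.
- have [i ci] : exists i, cyc (c i) (u * h).
    apply: covc; have [a [b [Ba Bb ->]]] := Hh.
    by exists (x * a), (y * b^-1); rewrite commg_shift.
  have ex : exists h, H h /\ cyc (c i) (u * h) by exists h.
  exists (g i, i) => /=.
    by apply/mapP; exists i; rewrite // mem_filter mem_enum andbT; apply/asboolP.
  have := sgM (cyc_sg _) (sgV (cyc_sg _) (gP i ex).2) ci.
  by rewrite invgM -mulgA mulKg.
exists i; split=> //.
have /mapP[p /mapP[j]] := i_s; rewrite mem_filter => /andP[/asboolP /gP[]] + + _ -> /= ->.
by exists (g j).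
Qed.

(** As z^x = y, [shifts x z] contains all [a, y]^u and all [b, x^z]. Since B is normal and x^(y u) =
    x^z, these are the conjugates by y u of the [b, y] and [b, x], so conjugating back gives one d
    for both. *)
Lemma pair_cyc x y : exists d, forall b, B b ->
  cyc d ([~ b, x] ^+ n) /\ cyc d ([~ b, y] ^+ n).
Proof.
pose z := y ^ (x^-1); pose u := [~ x, z].
have [i [_ iP]] := shifts_power x z.
have cyc_back v : cyc (c i) (v ^ (y * u)) -> cyc (c i ^ (y * u)^-1) v.
  by move=> /(cycJ (y * u)^-1); rewrite conjgK.
exists (c i ^ (y * u)^-1) => b Bb; split; apply: cyc_back.
  rewrite conjXg conjRg.
  have -> : x ^ (y * u) = x ^ z by rewrite /u /z /commg /conjg !gnorm.
  apply: iP; exists 1, (b ^ (y * u)).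
  by split; [exact: sg1|exact: nB|rewrite comm1g conj1g mul1g].
rewrite conjXg conjgM (conjRg b).
have -> : y ^ y = y by rewrite conjgE mulKg.
apply: iP; exists (b ^ y), 1.
by split; [exact: nB|exact: sg1|rewrite comm1g mulg1 /z conjgKV].
Qed.

(** Here u is the commutator [b^n, x], and [u, y] = [[b, x], y]^n lies with u in a common cyclic
    subgroup. By [conj_cyc], <u> is normal in G, and commutators act trivially on a normal cyclic
    subgroup. *)
Lemma derived_cent b x z : B b -> derived G z -> commute z ([~ b, x] ^+ n).
Proof.
move=> Bb Dz; set u := [~ b, x] ^+ n.
have Wu : commutators G u by exists (b ^+ n), x; rewrite commBX.
have uJ y : cyc u (u ^ y).
  have [d dP] := pair_cyc x y.
  apply: (conj_cyc covc Wu (dP b Bb).1).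
  have -> : u ^ y = u * [~ u, y] by rewrite commgEl mulVKg.
  apply: sgM (cyc_sg _) (dP b Bb).1 _; rewrite commBX; last exact: comm_normal.
  by case: (dP [~ b, x] (comm_normal x Bb)).
suff : cent [set u] z by apply.
apply: generated_sub z Dz; first exact: cent_sg.
by move=> _ [y [y' ->]] _ ->; apply: stab_commute; split.
Qed.

(** As x is in G', it centralises [b, x^q]^n; hence [b, x^q]^n = [b, x]^(nq), and the left side is
    trivial once x^q centralises B. *)
Lemma comm_exponent b x q : B b -> derived G x -> cent B (x ^+ q) ->
  [~ b, x] ^+ (n * q) = 1.
Proof.
move=> Bb Dx Cx; suff <- : [~ b, x ^+ q] ^+ n = [~ b, x] ^+ (n * q).
  by have /commgP/eqP -> := commute_sym (Cx _ Bb); rewrite expg1n.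
elim: q {Cx} => [|q IHq]; first by rewrite commg1 expg1n muln0.
rewrite (expgSr x) mulnS (expgnDr [~ b, x]) -IHq.
have -> : [~ b, x ^+ q * x] = [~ b, x] * [~ b, x ^+ q] ^ x.
  by rewrite /commg /conjg !gnorm.
rewrite expgMn; last by apply: aB; [|apply: nB]; apply: comm_normal.
congr (_ * _); rewrite -conjXg; apply/conjg_fixP/commgP/commute_sym.
exact: derived_cent.
Qed.
End AbelianNormalSubgroup.

(** * Metabelian groups, localised at a prime *)

Lemma derivedJ (G : groupType) (x y : G) : derived G x -> derived G (x ^ y).
Proof.
move=> Dx; apply: (@generated_sub _ (commutators G) [set x | derived G (x ^ y)]) Dx.
  split=> [|a b Da Db|a Da] /=; first by rewrite conj1g; exact: sg1 (generated_sg _).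
    by rewrite (conjMg a b); apply: (sgM (generated_sg _)).
  by rewrite (conjVg a); apply: (sgV (generated_sg _)).
by move=> w /(commutatorsJ y); apply: sub_generated.
Qed.

Lemma derivedR (G : groupType) (x y : G) : derived G [~ x, y].
Proof. by apply: sub_generated; exists x, y. Qed.

(* Membership in C after localising at p. *)
Definition plocal (G : groupType) p (C : set G) : set G :=
  [set a | exists2 r, ~~ (p %| r) & C (a ^+ r)].

Lemma plocal_sub (G : groupType) p (C : set G) : prime p -> C `<=` plocal p C.
Proof. by move=> p_pr x Cx; exists 1%N; rewrite ?Euclid_dvd1. Qed.

(** Localised at p, the subgroups of a cyclic group form a chain, ordered by the p-adic valuations
    of the exponents. *)
Lemma cyc_plocal_total (G : groupType) p (d u v : G) : prime p ->
  cyc d u -> cyc d v -> plocal p (cyc v) u \/ plocal p (cyc u) v.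
Proof.
move=> p_pr [a ->] [b ->].
have half (a' b' : int) : b' != 0%R -> logn p `|b'| <= logn p `|a'| ->
    plocal p (cyc (zpow d b')) (zpow d a').
  move=> b0 ba; set A := `|a'|%N in ba; set B := `|b'|%N in ba.
  have B_gt0 : 0 < B by rewrite absz_gt0.
  exists (B`_p^')%N; first by rewrite -p'natE // part_pnat.
  have /dvdzP[q eq] : (b' %| (a' * (B`_p^')%N%:Z)%R)%Z.
    rewrite dvdzE abszM -/A -/B -[X in X %| _](partnC p B_gt0) dvdn_mul //.
    by rewrite (dvdn_trans _ (dvdn_part p A)) // !p_part dvdn_exp2l.
  by exists q; rewrite -zpow_nat -!zpowM eq mulrC.
have [->|a0] := eqVneq a 0%R.
  by left; apply: plocal_sub => //; exists 0%R.
have [->|b0] := eqVneq b 0%R.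
  by right; apply: plocal_sub => //; exists 0%R.
have [le|/ltnW le] := leqP (logn p `|b|) (logn p `|a|).
  by left; apply: half.
by right; apply: half.
Qed.

Lemma plocal_sg (G : groupType) p (A C : set G) : prime p ->
    is_subgroup A -> (forall x y, A x -> A y -> commute x y) ->
  is_subgroup C -> is_subgroup [set a | A a /\ plocal p C a].
Proof.
move=> p_pr sA abA sC.
split=> [|x y [Ax [r pr Cr]] [Ay [s ps Cs]]|x [Ax [r pr Cr]]].
- by split; [exact: (sg1 sA)|apply: plocal_sub => //; exact: (sg1 sC)].
- split; first exact: (sgM sA).
  exists (r * s)%N; first by rewrite Euclid_dvdM // negb_or pr.
  rewrite expgMn; last exact: abA.
  apply: (sgM sC); first by rewrite expgnA; apply: (sgX _ sC).
  by rewrite mulnC expgnA; apply: (sgX _ sC).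
split; first exact: (sgV sA).
by exists r => //; rewrite expVgn; apply: (sgV sC).
Qed.

Section Metabelian.
Variables (G : groupType) (m : nat) (c : 'I_m -> G).
Hypothesis covc : forall w, commutators G w -> exists i, cyc (c i) w.
Hypothesis abD : forall x y, derived G x -> derived G y -> commute x y.
Variable p : nat.
Implicit Types (x y z a u v : G) (i : 'I_m).
Hypothesis p_pr : prime p.
Local Notation n := (neumann_exponent m).
Local Notation D := (derived G).

Let V i : set G := [set a | D a /\ plocal p (cyc (c i)) a].

Lemma V_sg i : is_subgroup (V i).
Proof. exact: plocal_sg (generated_sg _) abD (cyc_sg _). Qed.

Definition comm_powers : set G :=
  [set u | exists a x, D a /\ u = [~ a, x] ^+ n].
Local Notation U := comm_powers.

(** By [pair_cyc], u and v lie in one cyclic subgroup; locally at p one is a power of the other and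
    follows it into every V i. *)
Lemma V_chain u v : U u -> U v ->
  (forall i, V i v -> V i u) \/ (forall i, V i u -> V i v).
Proof.
have half u' v' : U u' -> plocal p (cyc v') u' -> forall i, V i v' -> V i u'.
  move=> [a [x [Da u'E]]] [r pr [z uz]] i [_ [s ps Cs]]; split.
    by rewrite u'E; apply: (sgX _ (generated_sg _)); exact: derivedR.
  exists (r * s)%N; first by rewrite Euclid_dvdM // negb_or pr.
  rewrite expgnA uz -zpow_nat -zpowM mulrC zpowM.
  exact: sgZ (cyc_sg _) Cs.
move=> Uu Uv; have [a [x [Da ux]]] := Uu; have [b [y [Db vy]]] := Uv.
have [d dP] := pair_cyc covc (generated_sg _) (@derivedJ G) abD x y.
have := cyc_plocal_total p_pr (dP a Da).1 (dP b Db).2; rewrite -ux -vy.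
by case=> /half h; [left; apply: h|right; apply: h].
Qed.

(* By V_chain the sets {i | V i u}, for u in U, form a chain; u = [a0, x0]^n is
   taken with the smallest one. *)
Lemma minimal_power : exists a0 x0, D a0 /\
  forall u i, U u -> V i ([~ a0, x0] ^+ n) -> V i u.
Proof.
pose I u := [set i | `[< V i u >]]%SET.
have exk : exists k, `[< exists2 u, U u & #|I u| = k >].
  exists #|I ([~ 1, 1] ^+ n)|; apply/asboolP; exists ([~ 1, 1] ^+ n) => //.
  by exists 1, 1; split=> //; exact: sg1 (generated_sg _).
have [k /asboolP[u0 Uu0 ku0] mink] := ex_minnP exk.
have [a0 [x0 [Da0 u0E]]] := Uu0.
exists a0, x0; split=> // u i Uu; rewrite -u0E.
have [|sub] := V_chain Uu Uu0; first exact.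
have subI : I u \subset I u0.
  apply/fintype.subsetP => j; rewrite !finset.in_set => /asboolP Vj.
  by apply/asboolP; apply: sub.
have /eqP eqI : I u == I u0.
  rewrite eqEcard subI ku0; apply: mink; apply/asboolP; by exists u.
move=> Vi; have : i \in I u0 by rewrite finset.in_set; apply/asboolP.
by rewrite -eqI finset.in_set => /asboolP.
Qed.

Lemma commgM_power x y z k :
  [~ x, y * z] ^+ k = [~ x, z] ^+ k * [~ x, y] ^+ k * [~ [~ x, y], z] ^+ k.
Proof.
have -> : [~ x, y * z] = [~ x, z] * [~ x, y] * [~ [~ x, y], z].
  by rewrite /commg /conjg !gnorm.
have sD : is_subgroup D := generated_sg _.
rewrite expgMn; last by apply: abD; [apply: (sgM sD)|]; apply: derivedR.
by rewrite expgMn //; apply: abD; apply: derivedR.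
Qed.

Section FixedIndex.
Variables (i : 'I_m) (k : nat).
Hypotheses (UV : U `<=` V i) (nk : n %| k).

(** This is the error term of [commgM_power]. As [x, y] is in G', it is a power of an element of U,
    so [x, y]^k is multiplicative in y modulo V i. *)
Let UVR x y z : V i ([~ [~ x, y], z] ^+ k).
Proof.
have [q ->] := dvdnP nk; rewrite mulnC expgnA; apply: (sgX _ (V_sg i)).
by apply: UV; exists [~ x, y], z; split=> //; apply: derivedR.
Qed.

Lemma V_commM x y z :
  V i ([~ x, y] ^+ k) -> V i ([~ x, z] ^+ k) -> V i ([~ x, y * z] ^+ k).
Proof.
move=> Vy Vz; have sV := V_sg i; rewrite commgM_power.
exact: (sgM sV (sgM sV Vz Vy) (UVR x y z)).
Qed.

Lemma V_commV x y : V i ([~ x, y] ^+ k) -> V i ([~ x, y^-1] ^+ k).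
Proof.
move=> Vy; have := commgM_power x y y^-1 k; rewrite mulgV commg1 expg1n => eq1.
have sV := V_sg i; apply: (sg_cancelr sV Vy).
by apply: (sg_cancelr sV (UVR x y y^-1)); rewrite -eq1; apply: sg1.
Qed.

Lemma V_commX x y j : V i ([~ x, y ^+ j] ^+ k) <-> V i ([~ x, y] ^+ (k * j)).
Proof.
have sV := V_sg i.
suff [v Vv ->] : exists2 v, V i v &
    [~ x, y ^+ j] ^+ k = [~ x, y] ^+ (k * j) * v.
  by split=> [|Vxy]; [apply: sg_cancelr|apply: sgM].
elim: j => [|j [v Vv IHj]].
  by exists 1; [apply: sg1|rewrite commg1 expg1n muln0 mulg1].
exists (v * [~ [~ x, y ^+ j], y] ^+ k); first exact: (sgM sV Vv (UVR _ _ _)).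
by rewrite (expgSr y) commgM_power IHj mulnS (expgnDr [~ x, y]) !mulgA.
Qed.

Lemma V_swap x y l : V i ([~ x, y] ^+ l) <-> V i ([~ y, x] ^+ l).
Proof.
by split=> /(sgV (V_sg i)); rewrite -expVgn invgR.
Qed.
End FixedIndex.

(* For every i with u0 in V i, the form (x, y) |-> [x, y]^n is bilinear modulo
   V i. An element z is good if some [a, z]^n is as bad as u0; then only such i
   are needed to cover the [z, y]. As z or x0 z is good, Neumann's lemma applies
   to the left radicals of these forms and their translates by x0^-1. *)
Lemma metabelian_plocal : exists i, forall x y, V i ([~ x, y] ^+ (n * n * n)).
Proof.
have sD : is_subgroup D := generated_sg _.
have [a0 [x0 [Da0]]] := minimal_power.
set u0 := [~ a0, x0] ^+ n => minU.
have Uu0 : U u0 by exists a0, x0.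
have UV i : V i u0 -> U `<=` V i by move=> Vi u Uu; apply: minU.
have commgMD a z d : D a -> D d -> [~ a, z * d] = [~ a, z].
  move=> Da Dd; have -> : [~ a, z * d] = [~ a, d] * [~ a, z] ^ d.
    by rewrite /commg /conjg !gnorm.
  have /commgP/eqP -> := abD Da Dd; rewrite mul1g.
  by apply/conjg_fixP/commgP/abD => //; apply: derivedR.
pose good z := exists2 a, D a & forall i, V i ([~ a, z] ^+ n) -> V i u0.
have goodV z y : good z -> exists2 i, V i u0 & V i ([~ z, y] ^+ n).
  (* The shifts of [z, y] contain [a, z^y] = [a, z], so the index i obtained satisfies V i u0. From
     [z, y] h and h^n in <c i> follows [z, y]^n in <c i>. *)
  move=> [a Da az]; have [i [[h hH ch] cH]] := shifts_power covc sD (@derivedJ G) abD z y.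
  have CV w : D w -> cyc (c i) w -> V i w by move=> Dw cw; split=> //; apply: plocal_sub.
  have Dh : D h.
    have [b [b' [Db Db' ->]]] := hH.
    by apply: (sgM sD); [apply: derivedJ|]; apply: derivedR.
  exists i.
    apply: az; apply: CV; first by apply: (sgX _ sD); apply: derivedR.
    apply: cH; exists 1, a; split=> //; first exact: sg1.
    rewrite comm1g conj1g mul1g.
    have -> : z ^ y = z * [~ z, y] by rewrite commgEl mulVKg.
    by rewrite commgMD //; apply: derivedR.
  apply: CV; first by apply: (sgX _ sD); apply: derivedR.
  apply: (sg_cancelr (cyc_sg _) (cH h hH)).
  by rewrite -expgMn; [apply: (sgX _ (cyc_sg _))|apply: abD => //; apply: derivedR].
have good_or z : good z \/ good (x0 * z).
  have [|ngz] := pselect (good z); [by left|right; exists a0 => // i].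
  have bad d : (exists2 a, D a & d = [~ a, z] ^+ n) -> exists2 j, V j d & ~ V j u0.
    move=> [a Da ->]; apply: contrapT => nbad; apply: ngz; exists a => // j Vj.
    by apply: contrapT => nVj; apply: nbad; exists j.
  rewrite commgM_power -/u0; set d := [~ a0, z] ^+ n; set d' := _ ^+ n.
  set u' := d * u0 * d' => Vu'; apply: contrapT => nVu0.
  have Uu' : U u' by exists a0, (x0 * z); rewrite commgM_power.
  have DR : D [~ a0, x0] by apply: derivedR.
  have Ud : U d by exists a0, z.
  have Ud' : U d' by exists [~ a0, x0], z.
  have [j Vjd nVj] : exists2 j, V j d & ~ V j u0 by apply: bad; exists a0.
  have [k Vkd' nVk] : exists2 k, V k d' & ~ V k u0 by apply: bad; exists [~ a0, x0].
  (* The index sets of u', d and d' form a chain and each has a member outside that of u0; for the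
     smallest set this member is common to all three. *)
  have [l [Vlu' Vld Vld' nVl]] : exists l, [/\ V l u', V l d, V l d' & ~ V l u0].
    case: (V_chain Uu' Ud) => ud; last first.
      by case: (V_chain Uu' Ud') => ud'; [exists k|exists i]; split; auto.
    by case: (V_chain Ud Ud') => dd'; [exists k|exists j]; split; auto.
  apply: nVl; apply: (sg_cancell (V_sg l) Vld).
  exact: (sg_cancelr (V_sg l) Vld').
have pointwise z : good z ->
    exists2 i, V i u0 & forall y, V i ([~ z, y] ^+ (n * n)).
  (* The premise V i u0 makes S i a subgroup for every i, namely G when it fails; only indices with
     V i u0 enter the covering. *)
  move=> gz; pose S i := [set y | V i u0 -> V i ([~ z, y] ^+ n)].
  pose s := [seq ((1 : G), i) | i <- enum 'I_m & `[< V i u0 >]].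
  have memS i : V i u0 -> (1, i) \in s.
    move=> Vi; apply/mapP; exists i => //.
    by rewrite mem_filter mem_enum andbT; apply/asboolP.
  have [|i|||h _|i i_s iP] := @neumann_power G m S setT s.
  - by [].
  - split=> [_|y y' Sy Sy' Vi|y Sy Vi].
    + by rewrite commg1 expg1n; apply: sg1 (V_sg _).
    + by apply: (V_commM (UV i Vi) (dvdnn _)); [apply: Sy|apply: Sy'].
    + by apply: (V_commV (UV i Vi) (dvdnn _)); apply: Sy.
  - rewrite size_map size_filter (leq_trans (count_size _ _)) //.
    by rewrite size_enum_ord -addnn leq_addr.
  - by [].
  - have [i Vi Vzh] := goodV z h gz; exists (1, i); first exact: memS.
    by rewrite /= invg1 mul1g.
  have Vi : V i u0.
    by have /mapP[q /mapP[j]] := i_s; rewrite mem_filter => /andP[/asboolP ? _] -> ->.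
  by exists i => // y; have := iP y I Vi; rewrite (V_commX (UV i Vi) (dvdnn _)).
pose S i := [set z | V i u0 -> forall y, V i ([~ z, y] ^+ (n * n))].
(* The coset of 1 serves when z is good, that of x0^-1 when x0 z is good. *)
pose s := [seq ((1 : G), i) | i <- enum 'I_m & `[< V i u0 >]] ++
          [seq (x0^-1, i) | i <- enum 'I_m & `[< V i u0 >]].
have memS x i : x \in [:: 1; x0^-1] -> V i u0 -> (x, i) \in s.
  move=> x01 Vi; have : i \in [seq i <- enum 'I_m | `[< V i u0 >]].
    by rewrite mem_filter mem_enum andbT; apply/asboolP.
  move: x01; rewrite !inE mem_cat => /orP[] /eqP -> js; apply/orP; [left|right];
    exact: map_f.
have nn : n %| n * n by apply: dvdn_mulr.
have [|i|||z _|i i_s iP] := @neumann_power G m S setT s.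
- by [].
- split=> [_ y|z z' Sz Sz' Vi y|z Sz Vi y].
  + by rewrite comm1g expg1n; apply: sg1 (V_sg _).
  + by apply/V_swap/(V_commM (UV i Vi) nn); apply/V_swap; [apply: Sz|apply: Sz'].
  + by apply/V_swap/(V_commV (UV i Vi) nn)/V_swap/Sz.
- rewrite size_cat !size_map size_filter -addnn leq_add //;
  by rewrite (leq_trans (count_size _ _)) // size_enum_ord.
- by [].
- have [gz|gz] := good_or z.
    have [i Vi Vz] := pointwise z gz; exists (1, i).
      by apply: memS; rewrite ?inE ?eqxx.
    by move=> _ y; rewrite /= invg1 mul1g.
  have [i Vi Vz] := pointwise _ gz; exists (x0^-1, i).
    by apply: memS; rewrite // !inE eqxx orbT.
  by move=> _ y; rewrite /= invgK.
have Vi : V i u0.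
  move: i_s; rewrite /unzip2 map_cat mem_cat => /orP[] /mapP[q /mapP[j]];
  by rewrite mem_filter => /andP[/asboolP ? _] -> ->.
exists i => x y; have := iP x I Vi y.
by move/V_swap/(V_commX (UV i Vi) nn)/V_swap.
Qed.
End Metabelian.

(** * From local to global cyclicity *)

Lemma int_subgroup_principal (P : int -> Prop) :
    P 0%R -> (forall a b, P a -> P b -> P (a + b)%R) ->
    (forall a, P a -> P (- a)%R) ->
  exists2 d, P d & forall x, P x -> (d %| x)%Z.
Proof.
move=> P0 PD PN.
have PM a (k : int) : P a -> P (k * a)%R.
  move=> Pa; elim/int_rect: k => [|k IHk|k IHk]; first by rewrite mul0r.
    have -> : (k.+1%:Z * a = k%:Z * a + a)%R by rewrite -addn1 PoszD mulrDl mul1r.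
    exact: PD.
  have -> : (- k.+1%:Z * a = - k%:Z * a - a)%R.
    by rewrite -addn1 PoszD opprD mulrDl mulN1r.
  by apply: PD => //; apply: PN.
have [[x Px x0]|nP] := pselect (exists2 x, P x & x != 0%R); last first.
  exists 0%R => // x Px; have [-> //|x0] := eqVneq x 0%R.
  by case: nP; exists x.
have exd : exists d : nat, (0 < d) && `[< P d >].
  exists `|x|%N; rewrite absz_gt0 x0; apply/asboolP.
  by case: (intP x) Px => [|k|k] //= /PN; rewrite opprK.
have [d /andP[d_gt0 /asboolP Pd] mind] := ex_minnP exd.
exists d => // y Py; apply/dvdz_mod0P.
have Pr : P (y %% d)%Z.
  have -> : (y %% d)%Z = (y + - ((y %/ d)%Z * d))%R.
    by rewrite {2}(divz_eq y d) addrAC subrr add0r.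
  by apply: PD => //; apply/PN/PM.
have [r rE] : exists r : nat, (y %% d)%Z = r.
  by exists `|(y %% d)%Z|%N; rewrite gez0_abs // modz_ge0; lia.
rewrite rE in Pr *; case: r rE Pr => // r rE Pr.
have := mind r.+1; rewrite (asboolT Pr) => /(_ isT).
by have := @ltz_pmod y d; rewrite rE; lia.
Qed.

Lemma coprimez_primes a b : a != 0%R ->
  (forall p, prime p -> (p %| a)%Z -> ~~ (p %| b)%Z) -> coprimez a b.
Proof.
move=> a0 pab; rewrite /coprimez; apply/eqP; apply: contrapT => g1.
have g_gt1 : 1 < gcdn `|a| `|b|.
  have : 0 < gcdn `|a| `|b| by rewrite gcdn_gt0 absz_gt0 a0.
  by move: g1; rewrite /gcdz; lia.
have /negP := pab _ (pdiv_prime g_gt1) (dvdn_trans (pdiv_dvd _) (dvdn_gcdl _ _)).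
by apply; apply: (dvdn_trans (pdiv_dvd _) (dvdn_gcdr _ _)).
Qed.

(** Let t be the part of |d| made of the primes not dividing e. A prime divisor of d divides exactly
    one of e and t f: if it divides e, it divides neither t nor f. *)
Lemma coprimez_shift (d e f : int) : d != 0%R ->
    (forall p, prime p -> ~~ [&& (p %| d)%Z, (p %| e)%Z & (p %| f)%Z]) ->
  exists t : int, coprimez d (e + t * f)%R.
Proof.
move=> d0 def; set A := `|d|%N; have A_gt0 : 0 < A by rewrite absz_gt0.
pose pi : nat_pred := [pred p | ~~ (p %| `|e|)].
exists (Posz (A`_pi)%N); apply: coprimez_primes => // p p_pr pd.
apply/negP => pe'; have := def p p_pr; rewrite pd /=.
have [pe|npe] := boolP (p %| e)%Z => /=.
  move/negP; apply.
  have : p %| (A`_pi * `|f|)%N.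
    rewrite -[(A`_pi)%N]/`|Posz (A`_pi)%N|%N -abszM -[p in p %| _]/`|Posz p|%N.
    by rewrite -dvdzE; move: pe'; rewrite rpredDl.
  rewrite Euclid_dvdM // => /orP[pt|//].
  have ppi : p \in pi.
    by apply: pnatPpi (part_pnat pi A) _; rewrite mem_primes p_pr part_gt0.
  by move: ppi; rewrite inE => /negP[]; exact: pe.
move=> _; have pt : p %| (A`_pi)%N.
  move: pd; rewrite dvdzE /= -/A -[X in _ %| X](partnC pi A_gt0) Euclid_dvdM //.
  case/orP=> // pt; have : p \in pi^'.
    by apply: pnatPpi (part_pnat pi^' A) _; rewrite mem_primes p_pr part_gt0.
  by rewrite !inE => /negP[]; exact: npe.
have ptf : (p %| (Posz (A`_pi)%N * f)%R)%Z by apply: dvdz_mulr.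
by move: npe; apply/negP; rewrite negbK -(rpredDr _ ptf).
Qed.

(** L is a subgroup of Z^2 generated by (d, e) and (0, f). By the local hypothesis no prime divides
    d, e and f together, so adding a multiple of (0, f) to (d, e) gives a coprime pair, unless d =
    0, when f is a unit. *)
Lemma lattice_coprime_pair (L : int -> int -> Prop) :
    L 0%R 0%R -> (forall a b a' b', L a b -> L a' b' -> L (a + a')%R (b + b')%R) ->
    (forall a b, L a b -> L (- a)%R (- b)%R) ->
    (forall p, prime p -> exists a b, L a b /\ ~~ ((p %| a)%Z && (p %| b)%Z)) ->
  exists a b, L a b /\ coprimez a b.
Proof.
move=> L0 LD LN Lp.
have LM a b (k : int) : L a b -> L (k * a)%R (k * b)%R.
  move=> Lab; elim/int_rect: k => [|k IHk|k IHk]; first by rewrite !mul0r.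
    by rewrite -addn1 PoszD !mulrDl !mul1r; apply: LD.
  rewrite -addn1 PoszD opprD !mulrDl !mulN1r.
  by apply: LD => //; apply: LN.
have [|a a' [b Lab] [b' La'b']|a [b Lab]|d [e Lde] dP] :=
    @int_subgroup_principal (fun a => exists b, L a b).
- by exists 0%R.
- by exists (b + b')%R; apply: LD.
- by exists (- b)%R; apply: LN.
have [//|b b' Lb Lb'|b Lb|f Lf fP] := @int_subgroup_principal (fun b => L 0%R b).
- by rewrite -[0%R]addr0; apply: LD.
- by rewrite -[0%R]oppr0; apply: LN.
have gen a b : L a b -> exists k l : int, a = (k * d)%R /\ b = (k * e + l * f)%R.
  move=> Lab; have [k ak] : exists k, a = (k * d)%R.
    by apply/dvdzP/dP; exists b.
  have [l bl] : exists l, (b - k * e = l * f)%R.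
    apply/dvdzP/fP; have := LD _ _ _ _ Lab (LN _ _ (LM _ _ k Lde)).
    by rewrite -ak subrr.
  by exists k, l; rewrite -bl addrC subrK.
have def p : prime p -> ~~ [&& (p %| d)%Z, (p %| e)%Z & (p %| f)%Z].
  move=> /Lp[a [b [/gen[k [l [-> ->]]]]]]; apply: contra => /and3P[pd pe pf].
  by rewrite dvdz_mull // rpredD // dvdz_mull.
have [d0|d0] := eqVneq d 0%R.
  exists 0%R, f; split=> //; rewrite /coprimez gcd0z.
  have e0 : (f %| e)%Z by apply: fP; rewrite -d0.
  apply/eqP; apply: contrapT => f1.
  have [f0|f0] := eqVneq f 0%R.
    by have := def 2 isT; rewrite d0 (eqP (_ : e == 0%R)) ?f0 ?dvdz0 // -dvd0z -f0.
  have f_gt1 : 1 < `|f| by lia.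
  have pf : (pdiv `|f| %| f)%Z by rewrite dvdzE /= pdiv_dvd.
  by have := def _ (pdiv_prime f_gt1); rewrite d0 dvdz0 pf (dvdz_trans pf e0).
have [t dt] := coprimez_shift d0 def.
by exists d, (e + t * f)%R; split=> //; rewrite -[d]addr0 -(mulr0 t); apply/LD/LM.
Qed.

(* A commuting pair a, b generates a cyclic group as soon as a^x b^y = 1 for some
   coprime x and y. *)
Lemma merge_cyclic (G : groupType) (a b : G) : commute a b ->
    (forall p, prime p -> exists d, plocal p (cyc d) a /\ plocal p (cyc d) b) ->
  exists s t : int, let e := zpow a s * zpow b t in cyc e a /\ cyc e b.
Proof.
move=> ab loc.
have cz x y : commute (zpow a x) (zpow b y).
  by apply/commute_zpow/commute_sym/commute_zpow/commute_sym.
pose L x y := zpow a x * zpow b y = 1.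
have [|x y x' y' Lxy Lxy'|x y Lxy|p p_pr|x [y [Lxy xy]]] := @lattice_coprime_pair L.
- by rewrite /L mulg1.
- rewrite /L !zpowD -mulgA (mulgA (zpow a x')) (cz x' y) -mulgA Lxy' mulg1.
  exact: Lxy.
- by rewrite /L !zpowN -invgM -cz Lxy invg1.
- have [d [[r pr [u au]] [s ps [v bv]]]] := loc p p_pr.
  have prs : ~~ (p %| r * s)%N by rewrite Euclid_dvdM // negb_or pr.
  have azrs z : zpow a ((r * s)%N%:Z * z)%R = zpow d (u * s%:Z * z)%R.
    have au' : zpow a r%:Z = zpow d u := au.
    by rewrite PoszM -mulrA zpowM au' -zpowM mulrA.
  have bzrs z : zpow b ((r * s)%N%:Z * z)%R = zpow d (v * r%:Z * z)%R.
    have bv' : zpow b s%:Z = zpow d v := bv.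
    by rewrite mulnC PoszM -mulrA zpowM bv' -zpowM mulrA.
  have [u0|u0] := eqVneq (u * s%:Z)%R 0%R.
    exists (Posz (r * s)%N), 0%R; split.
      by have := azrs 1%R; rewrite /L !mulr1 => ->; rewrite u0 mulg1.
    by rewrite dvdz0 andbT.
  (* From a^(rs) = d^(us) and b^(rs) = d^(vr), dividing by g gives a relation with exponents rs v'
     and -rs u'. As u' and v' are coprime and p does not divide rs, p does not divide both. *)
  pose g := gcdz (u * s%:Z)%R (v * r%:Z)%R.
  have [u' uE] := dvdzP (dvdz_gcdl (u * s%:Z)%R (v * r%:Z)%R).
  have [v' vE] := dvdzP (dvdz_gcdr (u * s%:Z)%R (v * r%:Z)%R).
  rewrite -/g in uE vE.
  exists (Posz (r * s)%N * v')%R, (Posz (r * s)%N * - u')%R; split.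
    rewrite /L azrs bzrs -zpowD uE vE -[RHS](zpow0 d); congr zpow.
    by ring.
  apply: contra prs => /andP[p1 p2].
  have g0 : g != 0%R by apply: contraNneq u0 => g0; rewrite uE g0 mulr0.
  have cop : coprimez u' v'.
    apply/eqP/(mulIf g0); rewrite mul1r {2}/g uE vE.
    by rewrite -[X in (_ * X)%R]gez0_abs ?mulz_gcdl.
  have /coprimezP[[w w'] /= ww'] := cop.
  have : (p %| (r * s)%N%:Z)%Z.
    rewrite -[X in (_ %| X)%Z]mulr1 -ww'.
    have -> : ((r * s)%N%:Z * (w * u' + w' * v') =
      ((r * s)%N%:Z * v') * w' - ((r * s)%N%:Z * - u') * w)%R by ring.
    by rewrite rpredB // dvdz_mulr.
  by rewrite dvdzE.
have /coprimezP[[s t] /= st] := xy.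
have aE : zpow a x = zpow b (- y)%R by rewrite zpowN; apply: divg1_eq; rewrite invgK.
(* With s x + t y = 1 and a^x = b^(-y), the y-th power of a^t b^(-s) is a and its (-x)-th power is
   b. *)
exists t, (- s)%R => /=; split.
  exists y; rewrite zpowMn // -!zpowM.
  have -> : (- s * y = - y * s)%R by ring.
  rewrite [zpow b _]zpowM -aE -zpowM -zpowD.
  have -> : (t * y + x * s = s * x + t * y)%R by ring.
  by rewrite st.
exists (- x)%R; rewrite zpowMn // -!zpowM.
have -> : (t * - x = x * - t)%R by ring.
rewrite zpowM aE -zpowM -zpowD.
have -> : (- y * - t + - s * - x = s * x + t * y)%R by ring.
by rewrite st.
Qed.

(** Induction by merging the head with the generator e0 of the tail. As e0 lies in the group
    generated by the tail, it inherits the local condition. *)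
Lemma locally_cyclic (G : groupType) (D : set G) (s : seq G) : is_subgroup D ->
    (forall x y, D x -> D y -> commute x y) -> (forall x, x \in s -> D x) ->
    (forall p, prime p -> exists d, forall x, x \in s -> plocal p (cyc d) x) ->
  exists2 e, generated [set x | x \in s] e & forall x, x \in s -> cyc e x.
Proof.
move=> sD abD; elim: s => [|a s IHs] sDs loc.
  by exists 1 => //; apply: sg1 (generated_sg _).
have as_ x : x \in s -> x \in a :: s by rewrite inE orbC => ->.
have [|p p_pr|e0 Ge0 e0s] := IHs.
- by move=> x /as_; apply: sDs.
- by have [d dP] := loc p p_pr; exists d => x /as_; apply: dP.
have Da : D a by apply: sDs; rewrite inE eqxx.
have sub : generated [set x | x \in s] `<=` D.
  by apply: generated_sub => // x /as_; apply: sDs.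
have [|p p_pr|k [l [ea ee0]]] := @merge_cyclic G a e0.
- exact: abD (sub _ Ge0).
- have [d dP] := loc p p_pr; exists d; split; first by apply: dP; rewrite inE eqxx.
  suff [] : [set x | D x /\ plocal p (cyc d) x] e0 by [].
  apply: generated_sub Ge0; first exact: plocal_sg (cyc_sg _).
  by move=> x xs; split; [apply/sDs/as_|apply/dP/as_].
exists (zpow a k * zpow e0 l).
  have sgen := generated_sg [set x | x \in a :: s].
  apply: (sgM sgen); apply: (sgZ _ sgen).
    by apply: sub_generated; rewrite /= inE eqxx.
  by apply: generated_sub Ge0 => // x /as_; apply: sub_generated.
move=> x; rewrite inE => /orP[/eqP -> //|/e0s].
exact: cyc_sub (cyc_sg _) ee0 _.
Qed.

(** G' is abelian, so x -> x^k is an endomorphism of it. Its image is locally cyclic at every prime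
    by [metabelian_plocal], hence cyclic, and the generator is itself a k-th power. *)
Lemma metabelian_power (G : groupType) m (c : 'I_m -> G) :
    (forall w, commutators G w -> exists i, cyc (c i) w) ->
    (forall x y, derived G x -> derived G y -> commute x y) ->
    (forall j, derived G (c j)) -> derived G `<=` generated (range c) ->
  let n := neumann_exponent m in exists2 a0, derived G a0 &
    forall x, derived G x -> cyc (a0 ^+ (n * n * n)) (x ^+ (n * n * n)).
Proof.
move=> covc abD Dc Dgen n; set k := (n * n * n)%N.
have sD : is_subgroup (derived G) := generated_sg _.
pose s := [seq c j ^+ k | j <- enum 'I_m].
have [//|//|x|p p_pr|e es eP] := @locally_cyclic G (derived G) s.
- by move=> /mapP[j _ ->]; apply: (sgX _ sD).
- have [i iP] := metabelian_plocal covc abD p_pr.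
  exists (c i) => _ /mapP[j _ ->].
  suff [] : [set x | derived G x /\
      (derived G (x ^+ k) /\ plocal p (cyc (c i)) (x ^+ k))] (c j).
    by move=> _ [].
  have sV := plocal_sg p_pr sD abD (cyc_sg (c i)).
  apply: generated_sub (Dc j) => [|w Ww].
    split=> [|x y [Dx Vx] [Dy Vy]|x [Dx Vx]].
    - by split; rewrite ?expg1n; [exact: (sg1 sD)|exact: (sg1 sV)].
    - split; first exact: (sgM sD).
      by rewrite expgMn; [exact: (sgM sV Vx Vy)|apply: abD].
    - by split; [exact: (sgV sD)|rewrite expVgn; exact: (sgV sV Vx)].
  by split; [apply: sub_generated|have [x [y ->]] := Ww; apply: iP].
have [a0 Da0 ea0] : [set x | exists2 a, derived G a & x = a ^+ k] e.
  apply: generated_sub es => [|x /mapP[j _ ->]]; last by exists (c j).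
  split=> [|_ _ [a Da ->] [b Db ->]|_ [a Da ->]].
  - by exists 1; rewrite ?expg1n; first exact: (sg1 sD).
  - by exists (a * b); [exact: (sgM sD)|rewrite expgMn //; apply: abD].
  - by exists a^-1; [exact: (sgV sD)|rewrite expVgn].
exists a0 => // x Dx; rewrite -ea0.
suff [] : [set x | derived G x /\ cyc e (x ^+ k)] x by [].
apply: generated_sub (Dgen x Dx) => [|_ [j _ <-]]; last first.
  by split=> //; apply: eP; apply/mapP; exists j; rewrite ?mem_enum.
have sC := cyc_sg e.
split=> [|y z [Dy Cy] [Dz Cz]|y [Dy Cy]].
- by split; rewrite ?expg1n; [exact: (sg1 sD)|exact: (sg1 sC)].
- split; first exact: (sgM sD).
  by rewrite expgMn; [exact: (sgM sC)|apply: abD].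
- by split; [exact: (sgV sD)|rewrite expVgn; exact: (sgV sC)].
Qed.

(** * Quotients *)

Section Quotients.
Variables (G : groupType) (N : normalSubgroup G).
Implicit Types x y : G.

Lemma cosetM x y : coset N (x * y) = coset N x * coset N y.
Proof. by rewrite -[RHS]/(quotient_mul _ _) quotient_mulE. Qed.

Lemma coset1 : coset N 1 = 1. Proof. by []. Qed.

Lemma cosetV x : coset N x^-1 = (coset N x)^-1.
Proof. by rewrite -[RHS]/(quotient_inv _) quotient_invE. Qed.

Lemma cosetX x k : coset N (x ^+ k) = coset N x ^+ k.
Proof. by elim: k => [|k IHk]; rewrite // !expgS cosetM IHk. Qed.

Lemma cosetZ x z : coset N (zpow x z) = zpow (coset N x) z.
Proof. by case: z => k; rewrite /= ?cosetV cosetX. Qed.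

Lemma cosetJ x y : coset N (x ^ y) = coset N x ^ coset N y.
Proof. by rewrite !conjgE !cosetM cosetV. Qed.

Lemma cosetR x y : coset N [~ x, y] = [~ coset N x, coset N y].
Proof. by rewrite !commgEl cosetM cosetV cosetJ. Qed.

Lemma coset_eq1 x : coset N x = 1 <-> carrier N x.
Proof.
rewrite -coset1; split=> [/esym/cosetP|Nx]; first by rewrite invg1 mul1g.
by apply/esym/cosetP; rewrite invg1 mul1g.
Qed.

Lemma quotient_sg (H : set G) : is_subgroup H -> is_subgroup (quotient N H).
Proof.
move=> sH; split=> [|_ _ [x Hx <-] [y Hy <-]|_ [x Hx <-]].
- by exists 1; [exact: (sg1 sH)|].
- by exists (x * y); [exact: (sgM sH)|rewrite cosetM].
- by exists x^-1; [exact: (sgV sH)|rewrite cosetV].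
Qed.

Lemma quotient_generated (A : set G) :
  generated (quotient N A) = quotient N (generated A).
Proof.
apply/seteqP; split.
  apply: generated_sub; first exact/quotient_sg/generated_sg.
  by move=> _ [x Ax <-]; exists x => //; apply: sub_generated.
move=> _ [x + <-]; apply: (@generated_sub _ A [set x | generated (quotient N A) (coset N x)]).
  have sQ := generated_sg (quotient N A).
  split=> [|a b Qa Qb|a Qa] /=; first exact: (sg1 sQ).
    by rewrite cosetM; apply: (sgM sQ).
  by rewrite cosetV; apply: (sgV sQ).
by move=> a Aa; apply: sub_generated; exists a.
Qed.

Lemma quotient_cover m (c : 'I_m -> G) :
    (forall w, commutators G w -> exists i, cyc (c i) w) ->
  forall w, commutators (quotient_group N) w -> exists i, cyc (coset N (c i)) w.
Proof.
move=> covc _ [u [v ->]]; rewrite -(coset_repr u) -(coset_repr v) -cosetR.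
have [|i [z ->]] := covc [~ repr u, repr v]; first by exists (repr u), (repr v).
by exists i, z; rewrite cosetZ.
Qed.

Lemma quotient_commutators :
  quotient N (commutators G) = commutators (quotient_group N).
Proof.
apply/seteqP; split=> [_ [_ [x [y ->]] <-]|_ [u [v ->]]].
  by exists (coset N x), (coset N y); rewrite cosetR.
rewrite -(coset_repr u) -(coset_repr v) -cosetR.
by exists [~ repr u, repr v]; first by exists (repr u), (repr v).
Qed.

Lemma quotient_derived : derived (quotient_group N) = quotient N (derived G).
Proof. by rewrite /derived -quotient_commutators quotient_generated. Qed.
End Quotients.

Section CommutatorSubgroups.
Variable G : groupType.
Implicit Types (x y z : G) (A B : set G).

Definition commset A B : set G :=
  [set w | exists x y, [/\ A x, B y & w = [~ x, y]]].

Lemma generated_commsetJ A B :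
    (forall x y, A x -> A (x ^ y)) -> (forall x y, B x -> B (x ^ y)) ->
  forall x y, generated (commset A B) x -> generated (commset A B) (x ^ y).
Proof.
move=> nA nB x y Cx.
have sC := generated_sg (commset A B).
apply: (@generated_sub _ (commset A B) [set x | generated (commset A B) (x ^ y)]) Cx.
  split=> [|a b Ca Cb|a Ca] /=; first by rewrite conj1g; exact: (sg1 sC).
    by rewrite (conjMg a b); apply: (sgM sC).
  by rewrite (conjVg a); apply: (sgV sC).
move=> _ [a [b [Aa Bb ->]]]; apply: sub_generated; exists (a ^ y), (b ^ y).
by rewrite conjRg; split; [apply: nA|apply: nB|].
Qed.

End CommutatorSubgroups.

Lemma quotient_commset (G : groupType) (N : normalSubgroup G) (A B : set G) :
  quotient N (commset A B) = commset (quotient N A) (quotient N B).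
Proof.
apply/seteqP; split=> [_ [_ [x [y [Ax By ->]]] <-]|_ [_ [_ [[x Ax <-] [y By <-] ->]]]].
  exists (coset N x), (coset N y); rewrite cosetR.
  by split=> //; [exists x|exists y].
by rewrite -cosetR; exists [~ x, y] => //; exists x, y.
Qed.

(** * Torsion in abelian groups with cyclic powers *)

Lemma subgroup_cyc (G : groupType) (H : set G) d : is_subgroup H ->
  H `<=` cyc d -> exists2 c, H c & H `<=` cyc c.
Proof.
move=> sH Hd; have [|a b Ha Hb|a Ha|z Hz zP] :=
    @int_subgroup_principal (fun z => H (zpow d z)).
- exact: (sg1 sH).
- by rewrite zpowD; apply: (sgM sH).
- by rewrite zpowN; apply: (sgV sH).
exists (zpow d z) => // x Hx; have [a xa] := Hd x Hx.
have /zP/dvdzP[q aE] : H (zpow d a) by rewrite -xa.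
by exists q; rewrite xa aE mulrC zpowM.
Qed.

Lemma cyc_torsion_card (G : groupType) (d : G) e : 0 < e ->
  card_le [set x | cyc d x /\ x ^+ e = 1] e.
Proof.
move=> e_gt0; set H := [set x | _].
have sH : is_subgroup H.
  split=> [|x y [dx xe] [dy ye]|x [dx xe]].
  - by split; [exact: (sg1 (cyc_sg d))|rewrite expg1n].
  - split; first exact: (sgM (cyc_sg d)).
    by rewrite expgMn ?xe ?ye ?mulg1 //; apply: cyc_commute dx dy.
  - by split; [exact: (sgV (cyc_sg d))|rewrite expVgn xe invg1].
have [|c [_ ce] Hc] := @subgroup_cyc G H d sH; first by move=> x [].
exists [seq c ^+ r | r <- iota 0 e]; first by rewrite size_map size_iota.
move=> x /Hc[z ->]; have [r rE] : exists r : nat, (z %% e)%Z = r.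
  by exists `|(z %% e)%Z|%N; rewrite gez0_abs // modz_ge0; lia.
apply/mapP; exists r.
  by rewrite mem_iota; have := @ltz_pmod z e; rewrite rE; lia.
by rewrite (divz_eq z e) rE zpowD mulrC zpowM zpow_nat ce zpow1n mul1g.
Qed.

(** Modulo k-th powers, the exponents of the generators may be reduced modulo k. *)
Lemma power_residues (G : groupType) (A : set G) k (s : seq G) : 0 < k ->
    is_subgroup A -> (forall x y, A x -> A y -> commute x y) ->
    (forall x, x \in s -> A x) ->
  exists2 w : seq G, size w <= k ^ size s & forall x,
    generated [set x | x \in s] x ->
    exists v y, [/\ v \in w, A y & x = v * y ^+ k].
Proof.
move=> k_gt0 sA abA; elim: s => [|a s IHs] sA'.
  exists [:: 1] => // x Gx; exists 1, 1; rewrite inE eqxx expg1n mulg1.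
  split=> //; first exact: (sg1 sA).
  suff : [set (1 : G)] x by [].
  apply: generated_sub Gx => //; split=> [//|y z -> ->|y ->]; rewrite ?mulg1 ?invg1 //.
have as_ x : x \in s -> x \in a :: s by rewrite inE orbC => ->.
have Aa : A a by apply: sA'; rewrite inE eqxx.
have [|w le_w wP] := IHs; first by move=> x /as_; apply: sA'.
have sub : generated [set x | x \in s] `<=` A.
  by apply: generated_sub => // x /as_; apply: sA'.
exists [seq a ^+ r * v | r <- iota 0 k, v <- w].
  by rewrite size_allpairs size_iota expnS leq_mul.
move=> x Gx.
have sG := generated_sg [set x | x \in s].
have [z [x' Gx' ->]] : [set x | exists z, exists2 x', generated [set x | x \in s] x'
    & x = zpow a z * x'] x.
  apply: generated_sub Gx => [|y /=].
    split=> [|_ _ [z [x' Gx' ->]] [z' [y' Gy' ->]]|_ [z [x' Gx' ->]]].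
    - by exists 0%R, 1; [exact: (sg1 sG)|rewrite mulg1].
    - exists (z + z')%R, (x' * y'); first exact: (sgM sG).
      rewrite zpowD -!mulgA; congr (_ * _); rewrite !mulgA; congr (_ * _).
      by apply: abA; [apply: sub|apply: (sgZ _ sA)].
    - exists (- z)%R, x'^-1; first exact: (sgV sG).
      rewrite zpowN -invgM; congr (_^-1).
      by apply: abA; [apply: (sgZ _ sA)|apply: sub].
  rewrite inE => /orP[/eqP ->|ys].
    by exists 1%R, 1; [exact: (sg1 sG)|rewrite mulg1].
  by exists 0%R, y; [apply: sub_generated|rewrite mul1g].
have [v [y [vw Ay x'E]]] := wP x' Gx'.
have [r rE] : exists r : nat, (z %% k)%Z = r.
  by exists `|(z %% k)%Z|%N; rewrite gez0_abs // modz_ge0; lia.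
exists (a ^+ r * v), (zpow a (z %/ k)%Z * y); split.
- apply/allpairsP; exists (r, v); split=> //=.
  by rewrite mem_iota; have := @ltz_pmod z k; rewrite rE; lia.
- by apply: (sgM sA) Ay; apply: (sgZ _ sA).
have Av : A v.
  apply: (sg_cancelr sA (sgX k sA Ay)); rewrite -x'E; exact: sub.
have Az : A (zpow a (z %/ k)%Z) by apply: (sgZ _ sA).
rewrite expgMn; last exact: abA.
rewrite {1}(divz_eq z k) addrC zpowD rE zpowM x'E -!mulgA; congr (_ * _).
rewrite !mulgA; congr (_ * _); apply: abA => //.
exact: (sgX _ sA).
Qed.

(** Two k-torsion elements with the same residue modulo k-th powers differ by a k-torsion element of
    <a0>, for which there are at most k choices. *)
Lemma torsion_card (G : groupType) (A : set G) k (s : seq G) a0 : 0 < k ->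
    is_subgroup A -> (forall x y, A x -> A y -> commute x y) ->
    (forall x, x \in s -> A x) -> A `<=` generated [set x | x \in s] ->
    (forall x, A x -> cyc a0 (x ^+ k)) ->
  card_le [set x | A x /\ x ^+ k = 1] (k * k ^ size s).
Proof.
move=> k_gt0 sA abA sA' As Ak.
have [w le_w wP] := power_residues k_gt0 sA abA sA'.
have [l le_l lP] := @cyc_torsion_card G a0 k k_gt0.
pose P v := [set x | (A x /\ x ^+ k = 1) /\ exists2 y, A y & x = v * y ^+ k].
exists [seq u * xget 1 (P v) | u <- l, v <- w].
  by rewrite size_allpairs leq_mul.
move=> x [Ax xk]; have [v [y [vw Ay xE]]] := wP x (As x Ax).
set r := fun v => xget 1 (P v); have [[Ar rk] [y' Ay' rE]] : P v (r v).
  by apply: xgetPex; exists x; split=> //; exists y.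
apply/allpairsP; exists (x * (r v)^-1, v); split=> //=; last by rewrite mulgVK.
apply: lP; split.
  have Av : A v by apply: (sg_cancelr sA (sgX k sA Ay)); rewrite -xE.
  rewrite xE rE (abA _ _ Av (sgX k sA Ay)) (abA _ _ Av (sgX k sA Ay')).
  rewrite invgM !mulgA mulgK -expVgn -expgMn; last by apply: abA => //; apply: (sgV sA).
  by apply: Ak; apply: (sgM sA) => //; apply: (sgV sA).
rewrite expgMn; last by apply: abA => //; apply: (sgV sA).
by rewrite xk expVgn rk mul1g invg1.
Qed.

(** * The second derived subgroup *)

Lemma leq_neumann_bound m : m <= neumann_bound m m.*2.
Proof.
suff le r N : N <= neumann_bound r N.
  by apply: leq_trans (le m m.*2); rewrite -addnn leq_addr.
by elim: r => //= r IHr; rewrite (leq_trans IHr) ?leq_addr.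
Qed.

(** [code m] labels the cosets of [normalizer]; [schur] turns this and the exponent n into an order
    bound, and the factorial into an exponent. *)
Definition schur_exponent m :=
  let B := #|{: code m}| in ((B * B).+1 ^ (B * B * neumann_exponent m)).+1`!.

(** The power j sends [DD] into [KK], and k * k * j kills [KK]. *)
Definition derived_exponent m :=
  let n := neumann_exponent m in let k := (n * n * n * n)%N in
  let j := (schur_exponent m * (n * n))%N in (j * (k * k * j))%N.

Section Assembly.
Variables (G : groupType) (m : nat) (c : 'I_m -> G).
Hypothesis covc : forall w, commutators G w -> exists i, cyc (c i) w.
Local Notation D := (derived G).
Hypothesis Dc : forall i, D (c i).
Hypothesis Dgen : D `<=` generated (range c).
Local Notation n := (neumann_exponent m).
Implicit Types (x y z a b v w : G).

Let sD : is_subgroup D. Proof. exact: generated_sg. Qed.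

Lemma cent_derived z : (forall w, commutators G w -> commute z w) -> cent D z.
Proof.
move=> zW y Dy; suff : cent [set z] y by move=> /(_ z erefl)/commute_sym.
apply: generated_sub Dy => [|w Ww _ ->]; first exact: cent_sg.
exact/commute_sym/zW.
Qed.

(** In this section [K] is the K0 of the opening sketch, and [D] is its K. *)
Definition normalizer : set G :=
  [set x | D x /\ forall w, commutators G w -> stab w x].
Local Notation K := normalizer.

Lemma normalizer_sg : is_subgroup K.
Proof.
split=> [|x y [Dx sx] [Dy sy]|x [Dx sx]].
- by split=> [|w _]; [exact: (sg1 sD)|exact: (sg1 (stab_sg w))].
- split=> [|w Ww]; first exact: (sgM sD).
  exact: (sgM (stab_sg w) (sx w Ww) (sy w Ww)).
- split=> [|w Ww]; first exact: (sgV sD).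
  exact: (sgV (stab_sg w) (sx w Ww)).
Qed.

Lemma normalizerJ x y : K x -> K (x ^ y).
Proof.
move=> [Dx sx]; split=> [|w Ww]; first exact: derivedJ.
have conj2 z u : cyc (w ^ y^-1) ((w ^ y^-1) ^ u) -> cyc w (w ^ (u ^ y)).
  by move=> /(cycJ y); rewrite -!conjgM mulVg conjg1 conjgE.
have [sx1 sx2] := sx _ (commutatorsJ y^-1 Ww).
by split; rewrite -?(conjVg x); apply: conj2.
Qed.

Lemma normalizer_cent a b : K a -> K b -> cent D [~ a, b].
Proof.
by move=> [_ sa] [_ sb]; apply: cent_derived => w Ww; apply: stab_commute; auto.
Qed.

Lemma normalizer_exponent x : D x -> K (x ^+ n).
Proof.
move=> Dx; split=> [|w Ww]; first exact: (sgX _ sD).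
have [lab labP] := stab_label covc Ww.
apply: (label_exponent (stab_sg w) labP).
by rewrite card_ord (leq_trans (leq_neumann_bound m)).
Qed.

(** Infinitely many w may occur, but each [stab w] has index at most m and [D] lies in an
    m-generated group, so [common_label] treats them together. *)
Lemma normalizer_label : exists lab : G -> code m,
  forall x y, D x -> D y -> lab x = lab y -> K (x * y^-1).
Proof.
have [S [w Ww <-]|lab labP] := @common_label G m c (@stab G @` commutators G).
  by split; [apply: stab_sg|apply: (stab_label covc Ww)].
exists lab => x y Dx Dy lxy; split; first exact: (sgM sD Dx (sgV sD Dy)).
by move=> w Ww; apply: (labP x y _ _ lxy); [apply: Dgen|apply: Dgen|exists w].
Qed.

Definition KK := NormalSubgroup (generated_sg (commset K K))
  (generated_commsetJ normalizerJ normalizerJ).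

Definition KD := NormalSubgroup (generated_sg (commset K D))
  (generated_commsetJ normalizerJ (@derivedJ G)).

Definition DD := NormalSubgroup (generated_sg (commset D D))
  (generated_commsetJ (@derivedJ G) (@derivedJ G)).

(** Modulo [KK], the normal subgroup [K] becomes abelian and contains x^n, so [comm_exponent]
    applies with q = n. *)
Lemma comm_KD_exponent b x : K b -> D x -> carrier KK ([~ b, x] ^+ (n * n)).
Proof.
move=> Kb Dx; apply/coset_eq1; rewrite cosetX cosetR.
apply: (@comm_exponent _ m (coset KK \o c) _ (quotient KK K)).
- exact: quotient_cover.
- exact/quotient_sg/normalizer_sg.
- move=> _ v [y Ky <-]; rewrite -(coset_repr v) -cosetJ.
  by exists (y ^ repr v) => //; apply: normalizerJ.
- move=> _ _ [y Ky <-] [z Kz <-]; apply/commgP/eqP; rewrite -cosetR.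
  by apply/coset_eq1; apply: sub_generated; exists y, z.
- by exists b.
- by rewrite quotient_derived; exists x.
move=> _ [y Ky <-]; rewrite -cosetX; apply/commgP/eqP; rewrite -cosetR.
apply/coset_eq1; apply: sub_generated; exists (x ^+ n), y; split=> //.
exact: normalizer_exponent.
Qed.

Lemma KD_exponent v : carrier KD v -> carrier KK (v ^+ (n * n)).
Proof.
move=> KDv; suff [] : [set v | K v /\ carrier KK (v ^+ (n * n))] v by [].
apply: generated_sub KDv => [|_ [b [x [Kb Dx ->]]]]; last first.
  split; last exact: comm_KD_exponent.
  rewrite commgEl; apply: (sgM normalizer_sg); last exact: normalizerJ.
  exact: (sgV normalizer_sg).
have sK := normalizer_sg; have sKK := carrier_subgroup KK.
split=> [|a b [Ka KKa] [Kb KKb]|a [Ka KKa]].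
- by split; rewrite ?expg1n; [exact: (sg1 sK)|exact: (sg1 sKK)].
- split; first exact: (sgM sK).
  apply/coset_eq1; rewrite cosetX cosetM expgMn.
    by rewrite -!cosetX (coset_eq1 KK _).2 // (coset_eq1 KK _).2 // mulg1.
  apply/commgP/eqP; rewrite -cosetR; apply/coset_eq1; apply: sub_generated.
  by exists a, b.
- by split; [exact: (sgV sK)|rewrite expVgn; exact: (sgV sKK)].
Qed.

(** Schur's theorem in D / KD, where the image of [K] is central. *)
Lemma DD_KD z : carrier DD z -> carrier KD (z ^+ schur_exponent m).
Proof.
have [lab labP] := normalizer_label.
pose lab' (u : quotient_group KD) : 'I_#|{: code m}| := enum_rank (lab (repr u)).
have sQ := quotient_sg KD sD.
have KDD : KD `<=` D.
  by apply: generated_sub => // _ [a [b [[Da _] Db ->]]]; apply: (sgR sD).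
have QP u : quotient KD D u -> D (repr u).
  move=> [x Dx xu]; have /cosetP/KDD := etrans (coset_repr u) (esym xu).
  by move=> Dux; have := sgV sD (sg_cancelr sD Dx Dux); rewrite invgK.
have Kcent y : K y -> cent (quotient KD D) (coset KD y).
  move=> Ky _ [x Dx <-]; apply/commgP/eqP; rewrite -cosetR.
  by apply/coset_eq1; apply: sub_generated; exists y, x.
have n_gt0 : 0 < n by apply: fact_gt0.
move=> DDz; rewrite /schur_exponent; apply/coset_eq1; rewrite cosetX.
apply: (card_le_exponent (generated_sg (commset (quotient KD D) (quotient KD D)))); last first.
  by rewrite -quotient_commset quotient_generated; exists z.
rewrite -{1}(prednK n_gt0); apply: (@schur _ (quotient KD D) _ n.-1 lab' sQ).
- move=> u v Qu Qv /enum_rank_inj /(labP _ _ (QP u Qu) (QP v Qv)) /Kcent.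
  by rewrite cosetM cosetV !coset_repr.
move=> _ [x Dx <-]; rewrite prednK // -cosetX; apply: Kcent.
exact: normalizer_exponent.
Qed.
Local Notation j := (schur_exponent m * (n * n))%N.

Lemma DD_KK z : carrier DD z -> carrier KK (z ^+ j).
Proof. by move=> DDz; rewrite expgnA; apply: KD_exponent; apply: DD_KD. Qed.

Lemma KK_cent z : carrier KK z -> D z /\ cent D z.
Proof.
move=> KKz; suff : [set z | D z /\ cent D z] z by [].
apply: generated_sub KKz => [|_ [a [b [Ka Kb ->]]]].
  split=> [|x y [Dx Cx] [Dy Cy]|x [Dx Cx]].
  - by split; [exact: (sg1 sD)|exact: (sg1 (cent_sg D))].
  - by split; [exact: (sgM sD)|exact: (sgM (cent_sg D))].
  - by split; [exact: (sgV sD)|exact: (sgV (cent_sg D))].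
by split; [exact: derivedR|exact: normalizer_cent].
Qed.

(** Commutators of [K] are central in [D], so [K] has class at most 2 and its commutator map is
    bilinear. *)
Lemma comm_normalizerMl a b h : K a -> K b -> K h ->
  [~ a * b, h] = [~ a, h] * [~ b, h].
Proof.
move=> Ka Kb Kh; have -> : [~ a * b, h] = [~ a, h] ^ b * [~ b, h].
  by rewrite /commg /conjg !gnorm.
congr (_ * _); apply/conjg_fixP/commgP; apply: (normalizer_cent Ka Kh).
by case: Kb.
Qed.

Lemma comm_normalizerXl a h i : K a -> K h -> [~ a ^+ i, h] = [~ a, h] ^+ i.
Proof.
move=> Ka Kh; elim: i => [|i IHi]; first by rewrite comm1g.
by rewrite (expgS a) comm_normalizerMl ?IHi -?expgS //; apply: (sgX _ normalizer_sg).
Qed.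

Lemma comm_normalizerXX a b i : K a -> K b ->
  [~ a ^+ i, b ^+ i] = [~ a, b] ^+ (i * i).
Proof.
move=> Ka Kb; have Kbi : K (b ^+ i) by apply: (sgX _ normalizer_sg).
rewrite comm_normalizerXl // -(invgR (b ^+ i)) comm_normalizerXl // -expVgn.
by rewrite invgR expgnA.
Qed.

Lemma derived_power : exists2 a0, D a0 & forall x, D x ->
  cyc (coset DD a0 ^+ (n * n * n)) (coset DD x ^+ (n * n * n)).
Proof.
have [|||u|a] := @metabelian_power (quotient_group DD) m (coset DD \o c).
- exact: quotient_cover.
- rewrite quotient_derived => _ _ [x Dx <-] [y Dy <-].
  apply/commgP/eqP; rewrite -cosetR.
  by apply/coset_eq1; apply: sub_generated; exists x, y.
- by move=> i; rewrite quotient_derived; exists (c i).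
- rewrite quotient_derived (_ : range _ = quotient DD (range c)).
    by rewrite quotient_generated => -[x /Dgen Gx <-]; exists x.
  by rewrite /quotient image_comp.
rewrite quotient_derived => -[a0 Da0 <-] aP; exists a0 => // x Dx.
by apply: aP; exists x.
Qed.

Local Notation k := (n * n * n * n)%N.

(** Modulo [DD], a^k and b^k are powers of t = a0^n; the fourth factor n in k puts t into [K]. In
    [a^k, b^k] = [a, b]^(k k) the powers of t commute, and the factors involving y in [DD] are
    killed by j, since y^j is central in [D]. *)
Lemma comm_normalizer_exponent a b : K a -> K b ->
  [~ a, b] ^+ (k * k * j) = 1.
Proof.
move=> Ka Kb; have [a0 Da0 a0P] := derived_power.
have sK := normalizer_sg; pose t := a0 ^+ n.
have Kt : K t by apply: normalizer_exponent.
have dec x : K x -> exists s y, [/\ carrier DD y, K y & x ^+ k = zpow t s * y].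
  move=> Kx; have [s xs] := a0P x Kx.1.
  pose y := (zpow t ((n * n * n)%N%:Z * s)%R)^-1 * x ^+ k.
  exists ((n * n * n)%N%:Z * s)%R, y; split; last by rewrite mulVKg.
    apply/coset_eq1; rewrite cosetM cosetV cosetZ !cosetX [_ ^+ k]expgnA xs.
    rewrite -[coset DD a0 ^+ n]zpow_nat -[coset DD a0 ^+ _]zpow_nat -zpow_nat -!zpowM.
    by rewrite [(n%:Z * _)%R]mulrC -mulrA mulVg.
  by apply: (sgM sK); [apply: (sgV sK); apply: (sgZ _ sK)|apply: (sgX _ sK)].
have jtriv y h : carrier DD y -> K y -> K h -> [~ y, h] ^+ j = 1.
  move=> DDy Ky Kh; rewrite -comm_normalizerXl //; apply/eqP/commgP.
  by apply: (KK_cent (DD_KK DDy)).2; case: Kh.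
have comm_cent u v w h : K u -> K v -> K w -> K h -> commute [~ u, v] [~ w, h].
  by move=> Ku Kv Kw Kh; apply: (normalizer_cent Ku Kv); apply: derivedR.
have KZ s : K (zpow t s) by apply: (sgZ _ sK).
rewrite expgnA -comm_normalizerXX //.
have [s [y [DDy Ky ->]]] := dec a Ka; have [s' [y' [DDy' Ky' ->]]] := dec b Kb.
have Kb' : K (zpow t s' * y') by apply: (sgM sK).
rewrite comm_normalizerMl // expgMn; last exact: comm_cent.
rewrite (jtriv y) // mulg1 -invgR expVgn comm_normalizerMl //.
have /commgP/eqP -> : commute (zpow t s') (zpow t s).
  by apply: (@cyc_commute _ t); [exists s'|exists s].
by rewrite mul1g jtriv // invg1.
Qed.

Lemma DD_exponent z : carrier DD z -> z ^+ derived_exponent m = 1.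
Proof.
move=> DDz; have -> : z ^+ derived_exponent m = z ^+ j ^+ (k * k * j).
  by rewrite -expgnA.
move: (z ^+ j) (DD_KK DDz) => v KKv.
suff [_ Hv] : [set v | (D v /\ cent D v) /\ v ^+ (k * k * j) = 1] v by [].
apply: generated_sub KKv => [|_ [a [b [Ka Kb ->]]]].
  split=> [|x y [[Dx Cx] ex] [[Dy Cy] ey]|x [[Dx Cx] ex]].
  - split; last by rewrite expg1n.
    by split; [exact: (sg1 sD)|exact: (sg1 (cent_sg D))].
  - split; first by split; [exact: (sgM sD)|exact: (sgM (cent_sg D))].
    by rewrite expgMn; [rewrite ex ey mulg1|apply: Cx].
  - split; first by split; [exact: (sgV sD)|exact: (sgV (cent_sg D))].
    by rewrite expVgn ex invg1.
split; last exact: comm_normalizer_exponent.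
by split; [exact: derivedR|exact: normalizer_cent].
Qed.

Local Notation e := (derived_exponent m).

Lemma neumann_exponent_gt0 : 0 < n. Proof. exact: fact_gt0. Qed.

Lemma derived_exponent_gt0 : 0 < e.
Proof.
have s_gt0 : 0 < schur_exponent m by apply: fact_gt0.
rewrite /derived_exponent; move: n (schur_exponent m) neumann_exponent_gt0 s_gt0.
by move=> p q p_gt0 q_gt0; rewrite !muln_gt0 p_gt0 q_gt0.
Qed.

(** Commutators of elements of [D] satisfy x^e = 1, so each <c i> contains at most e of them, and
    Dietzmann's argument replaces x^e by the empty word. *)
Lemma card_DD : card_le (carrier DD) ((m * e).+1 ^ (m * e * e.-1)).
Proof.
have XD w : commset D D w -> D w by move=> [x [y [_ _ ->]]]; apply: derivedR.
apply: generated_card derived_exponent_gt0 _ => [x y||| x Xx].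
- move=> [a [b [Da Db ->]]] /XD Dy; exists (a ^ y), (b ^ y).
  by rewrite conjRg; split; [exact: derivedJ|exact: derivedJ|].
- by move=> _ [x [y [Dx Dy ->]]]; exists y, x; rewrite invgR.
- have /choice[s sP] i : exists s : seq G, size s <= e /\
      forall x, cyc (c i) x /\ x ^+ e = 1 -> x \in s.
    by have [s] := cyc_torsion_card (c i) derived_exponent_gt0; exists s.
  exists [seq nth 1 (s i) r | i <- enum 'I_m, r <- iota 0 e].
    by rewrite size_allpairs size_iota size_enum_ord.
  move=> x Xx; have [i ci] : exists i, cyc (c i) x.
    by apply: covc; have [a [b [_ _ ->]]] := Xx; exists a, b.
  have xs : x \in s i.
    by apply: (sP i).2; split=> //; apply: DD_exponent; apply: sub_generated.
  apply/allpairsP; exists (i, index x (s i)); rewrite mem_enum mem_iota /=.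
  by split; rewrite ?nth_index // add0n (leq_trans _ (sP i).1) // index_mem.
exists [::] => //; split; first exact: derived_exponent_gt0.
by rewrite DD_exponent //; apply: sub_generated.
Qed.

End Assembly.

(** * The characteristic subgroup *)

(** The factor k * k ^ m bounds the k-torsion of D / DD, the rest the order of [DD]. *)
Definition kernel_bound m :=
  let n := neumann_exponent m in let k := (n * n * n)%N in
  let e := derived_exponent m in (k * k ^ m * (m * e).+1 ^ (m * e * e.-1))%N.

Section Kernel.
Variables (G : groupType) (m : nat).
Local Notation n := (neumann_exponent m).
Local Notation k := (n * n * n)%N.
Local Notation D := (derived G).
Implicit Types (x y : G).

Let sD : is_subgroup D. Proof. exact: generated_sg. Qed.

Lemma quotient_DD_commute u v : quotient (DD G) D u -> quotient (DD G) D v ->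
  commute u v.
Proof.
move=> [x Dx <-] [y Dy <-]; apply/commgP/eqP; rewrite -cosetR.
by apply/coset_eq1; apply: sub_generated; exists x, y.
Qed.

(** The preimage of the k-torsion of G'/G''. The c i do not enter, which makes it characteristic. *)
Definition kernel : set G := [set x | D x /\ carrier (DD G) (x ^+ k)].

Lemma kernelP x : kernel x <-> D x /\ coset (DD G) x ^+ k = 1.
Proof. by rewrite -cosetX; split=> -[Dx /coset_eq1]. Qed.

Lemma kernel_sg : is_subgroup kernel.
Proof.
split=> [|x y /kernelP[Dx kx] /kernelP[Dy ky]|x /kernelP[Dx kx]]; apply/kernelP.
- by split; [exact: (sg1 sD)|rewrite coset1 expg1n].
- split; first exact: (sgM sD).
  rewrite cosetM expgMn ?kx ?ky ?mulg1 //.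
  by apply: quotient_DD_commute; [exists x|exists y].
- by split; [exact: (sgV sD)|rewrite cosetV expVgn kx invg1].
Qed.

Lemma kernelJ x y : kernel x -> kernel (x ^ y).
Proof.
move=> /kernelP[Dx kx]; apply/kernelP; split; first exact: derivedJ.
by rewrite cosetJ -conjXg kx conj1g.
Qed.

(** [D] and [DD] are generated by sets that every endomorphism preserves. A bare multiplicative map
    is taken so that the inverse of an automorphism is covered too. *)
Lemma kernel_morph (phi : G -> G) : {morph phi : x y / x * y} ->
  forall x, kernel x -> kernel (phi x).
Proof.
move=> phiM.
have phi1 : phi 1 = 1 by apply: (mulgI (phi 1)); rewrite -phiM !mulg1.
have phiV x : phi x^-1 = (phi x)^-1.
  by apply/esym/mulg1_eq; rewrite -phiM mulgV.
have phiX x i : phi (x ^+ i) = phi x ^+ i.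
  by elim: i => // i IHi; rewrite !expgS phiM IHi.
have phiR x y : phi [~ x, y] = [~ phi x, phi y].
  by rewrite !(commgEl, conjgE) !phiM !phiV.
have phi_gen (A : set G) : (forall x, A x -> A (phi x)) ->
    forall x, generated A x -> generated A (phi x).
  move=> Aphi x Ax; have sA := generated_sg A.
  apply: (@generated_sub _ A [set x | generated A (phi x)]) Ax.
    split=> [|y z Ay Az|y Ay] /=; first by rewrite phi1; exact: (sg1 sA).
      by rewrite phiM; apply: (sgM sA).
    by rewrite phiV; apply: (sgV sA).
  by move=> y /Aphi; apply: sub_generated.
have phiD x : D x -> D (phi x).
  apply: phi_gen => _ [y [z ->]]; rewrite phiR; by exists (phi y), (phi z).
move=> x [Dx kx]; split; first exact: phiD.
rewrite -phiX; apply: phi_gen kx => _ [y [z [Dy Dz ->]]].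
by rewrite phiR; exists (phi y), (phi z); split=> //; apply: phiD.
Qed.

Lemma kernel_characteristic : characteristic kernel.
Proof.
split=> [|phi [psi phiK psiK]]; first exact: kernel_sg.
have phiM : {morph phi : x y / x * y} by move=> x y; apply: gmulfM.
have psiM : {morph psi : x y / x * y}.
  by move=> x y; apply: (can_inj phiK); rewrite phiM !psiK.
apply/seteqP; split=> [_ [x kx <-]|x kx]; first exact: (kernel_morph phiM).
by exists (psi x); [exact: (kernel_morph psiM)|exact: psiK].
Qed.

Variable c : 'I_m -> G.
Hypothesis covc : forall w, commutators G w -> exists i, cyc (c i) w.
Hypothesis Dc : forall i, D (c i).
Hypothesis Dgen : D `<=` generated (range c).

Lemma kernel_card : card_le kernel (kernel_bound m).
Proof.
have k_gt0 : 0 < k.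
  have := neumann_exponent_gt0 m; move: n => p p_gt0.
  by rewrite !muln_gt0 p_gt0.
have [a0 Da0 a0P] := derived_power covc Dc Dgen.
pose s := [seq coset (DD G) (c i) | i <- enum 'I_m].
have [|||l le_l lP] := torsion_card (s := s) (a0 := coset (DD G) a0 ^+ k) k_gt0
  (quotient_sg (DD G) sD) quotient_DD_commute.
- by move=> _ /mapP[i _ ->]; exists (c i).
- move=> _ [x /Dgen Gx <-].
  suff : generated (quotient (DD G) (range c)) (coset (DD G) x).
    apply: generated_sub; first exact: generated_sg.
    move=> _ [_ [i _ <-] <-]; apply: sub_generated.
    by apply/mapP; exists i; rewrite ?mem_enum.
  by rewrite quotient_generated; exists x.
- by move=> _ [x Dx <-]; apply: a0P.
have [d le_d dP] := card_DD covc Dc Dgen.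
exists [seq repr u * h | u <- l, h <- d].
  by rewrite size_allpairs leq_mul // (leq_trans le_l) // size_map size_enum_ord.
move=> x /kernelP[Dx kx]; apply/allpairsP.
exists (coset (DD G) x, (repr (coset (DD G) x))^-1 * x); split=> /=.
- by apply: lP; split=> //; exists x.
- by apply/dP/cosetP/coset_repr.
- by rewrite mulVKg.
Qed.

Definition kernel_normal := NormalSubgroup kernel_sg kernelJ.

(** If x^k = (a0^k)^z modulo [DD], then a0^(-z) x is k-torsion in the abelian group D / DD, so a0
    generates modulo [kernel]. *)
Lemma kernel_quotient_cyclic : cyclic (quotient kernel_normal D).
Proof.
have [a0 Da0 a0P] := derived_power covc Dc Dgen.
exists (coset kernel_normal a0); rewrite cyc_generated.
apply/seteqP; split; last first.
  by move=> _ [z ->]; exists (zpow a0 z); [exact: (sgZ _ sD)|rewrite cosetZ].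
move=> _ [x Dx <-]; have [z xz] := a0P x Dx.
exists z; rewrite -cosetZ; apply/esym/cosetP/kernelP; split.
  by apply: (sgM sD) Dx; apply: (sgV sD); apply: (sgZ _ sD).
rewrite cosetM cosetV cosetZ expgMn; last first.
  apply: quotient_DD_commute; last by exists x.
  by apply: (sgV (quotient_sg _ sD)); apply: (sgZ _ (quotient_sg _ sD)); exists a0.
by rewrite expVgn xz -[_ ^+ k]zpow_nat -[coset _ a0 ^+ k]zpow_nat -!zpowM mulrC mulVg.
Qed.
End Kernel.

Theorem theoremC :
  exists f : nat -> nat,
    forall (m : nat) (G : groupType), 0 < m ->
    forall C : 'I_m -> set G,
      (forall i : 'I_m, is_subgroup (C i) /\ cyclic (C i)) ->
      commutators G `<=` \bigcup_(i in [set: 'I_m]) C i ->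
    exists M : normalSubgroup G,
      [/\ characteristic M,
          M `<=` derived G,
          finite_set M,
          M #<= `I_(f m) &
          cyclic (quotient M (derived G))].
Proof.
exists kernel_bound => m G _ C Ccyc covC.
(* Each C i is replaced by the subgroup generated by the commutators it contains. Its generator c i
   then lies in G', the covering persists, and the c i generate G'. *)
have /choice[c cP] i : exists c, generated (C i `&` commutators G) c /\
    generated (C i `&` commutators G) `<=` cyc c.
  have [sC [d Cd]] := Ccyc i.
  have [||c Hc cH] := @subgroup_cyc G (generated (C i `&` commutators G)) d.
  - exact: generated_sg.
  - by rewrite -cyc_generated -Cd; apply: generated_sub => // x [].
  by exists c.
have covc w : commutators G w -> exists i, cyc (c i) w.
  move=> Ww; have [i _ Ciw] := covC w Ww; exists i.
  by apply: (cP i).2; apply: sub_generated.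
have Dc i : derived G (c i).
  apply: generated_sub (cP i).1; first exact: generated_sg.
  by move=> w [_ Ww]; apply: sub_generated.
have Dgen : derived G `<=` generated (range c).
  apply: generated_sub => [|w /covc[i ciw]]; first exact: generated_sg.
  by apply: (cyc_sub (generated_sg _) _ ciw); apply: sub_generated; exists i.
exists (kernel_normal G m).
have [l le_l lP] := kernel_card covc Dc Dgen.
have kl : kernel m `<=` [set` l] by move=> x /lP.
split.
- exact: kernel_characteristic.
- by move=> x [].
- exact: sub_finite_set kl (finite_seq l).
- have inj : {in kernel m &, injective (index^~ l)}.
    move=> x y; rewrite !inE => /lP xl /lP yl xy.
    by rewrite -(nth_index 1 xl) xy nth_index.
  rewrite -(card_le_eql (inj_card_eq inj)); apply: subset_card_le.
  by move=> _ [x /lP xl <-] /=; rewrite (leq_trans _ le_l) // index_mem.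
- exact: (kernel_quotient_cyclic covc Dc Dgen).
Qed.
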